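(* Let $\kappa_m>0$ and $p\ge 4$. Let $\mathcal{G}\colon X^{\kappa_m,p}\to\mathbb{R}$ be any function that is lower semicontinuous with respect to the $W^{3,p}(I;\mathbb{R}^3)$-norm and such that $\mathcal{G}(\mathbf{u})\le \mathcal{F}(\mathbf{u},I)$ for all $\mathbf{u}$ in the dense subset $Y^{\kappa_m}$. Then $\mathcal{G}(\mathbf{u})\le\mathcal{F}(\mathbf{u},I)$ for all $\mathbf{u}\in X^{\kappa_m,p}$. Moreover, for every $\mathbf{u}\in X^{\kappa_m,p}$, $$\Gamma\text{-}\lim_{\varepsilon\searrow 0}\mathcal{F}_\varepsilon(\mathbf{u},I)=\mathcal{F}(\mathbf{u},I)$$ with respect to the strong topology of $W^{3,p}(I;\mathbb{R}^3)$ on $X^{\kappa_m,p}$.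
   Context: $I=(0,1)$. Fix $\mathbf{A},\mathbf{B}\in\mathbb{R}^3\times\mathbb{S}^2$. For a curve $\mathbf{u}$ write $D^{[1]}\mathbf{u}(t)=(\mathbf{u}(t),\mathbf{u}'(t))$. Define $$Y=\{\mathbf{u}\in C^\infty([0,1];\mathbb{R}^3): D^{[1]}\mathbf{u}(0)=\mathbf{A},\ D^{[1]}\mathbf{u}(1)=\mathbf{B},\ |\mathbf{u}'(s)|=1\text{ for all }s\in I\},$$ $Y^{\kappa_m}=\{\mathbf{u}\in Y:|\mathbf{u}''(s)|\ge\kappa_m\text{ for all }s\in I\}$, and let $X^{\kappa_m,p}$ be the closure of $Y^{\kappa_m}$ in the norm of $W^{3,p}(I;\mathbb{R}^3)$. For $\mathbf{u}\in X^{\kappa_m,p}$ put $\kappa=|\mathbf{u}''|$ and $\eta=\dfrac{\mathbf{u}'\cdot(\mathbf{u}''\times\mathbf{u}''')}{|\mathbf{u}''|^3}$. The Sadowsky functional is $\mathcal{F}(\mathbf{u},I)=\int_I\kappa^2(1+\eta^2)^2\,ds$. Let $g\colon\mathbb{R}\to[1,+\infty]$ be $g(0)=1$, $g(x)=\frac1x\ln\frac{2+x}{2-x}$ for $0<|x|<2$, and $g(x)=+\infty$ for $|x|\ge2$. For $\varepsilon>0$, $\mathcal{F}_\varepsilon(\mathbf{u},I)=\int_I\kappa^2(1+\eta^2)^2g(\varepsilon\eta')\,ds$ if $\eta\in W^{1,1}(I)$, and $\mathcal{F}_\varepsilon(\mathbf{u},I)=+\infty$ otherwise. The statement that $\mathcal{F}$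 is the $\Gamma$-limit of $\mathcal{F}_\varepsilon$ on $X=X^{\kappa_m,p}$ as $\varepsilon\searrow0$ with respect to a mode of convergence means: for every sequence $\varepsilon_j>0$ with $\varepsilon_j\to0$ and every $\mathbf{u}\in X$, (1) $\mathcal{F}(\mathbf{u},I)\le\liminf_j\mathcal{F}_{\varepsilon_j}(\mathbf{u}_j,I)$ for every sequence $\{\mathbf{u}_j\}\subset X$ converging to $\mathbf{u}$; and (2) there is a sequence $\{\mathbf{u}_j\}\subset X$ converging to $\mathbf{u}$ with $\mathcal{F}(\mathbf{u},I)\ge\limsup_j\mathcal{F}_{\varepsilon_j}(\mathbf{u}_j,I)$. Here convergence is norm convergence in $W^{3,p}(I;\mathbb{R}^3)$. *)

(* Defs.v *)
From HB Require Import structures.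
From mathcomp Require Import all_boot all_order all_algebra.
From mathcomp Require Import all_classical all_reals all_analysis.

Set Implicit Arguments.
Unset Strict Implicit.
Unset Printing Implicit Defensive.
Import Order.TTheory GRing.Theory Num.Theory.
Import numFieldNormedType.Exports.

Local Open Scope classical_set_scope.
Local Open Scope ring_scope.

Section Euclidean3.
Context {R : realType}.
Implicit Types v w : 'rV[R]_3.

Definition dot v w : R := \sum_(i < 3) v 0 i * w 0 i.

(* The library norm on row vectors is the max norm. *)
Definition enorm v : R := Num.sqrt (dot v v).

(* Addition in 'I_3 is modulo 3, so the indices i, i + 1, i + 2 are cyclic. *)
Definition cross v w : 'rV[R]_3 :=
  \row_(i < 3) (v 0 (i + 1) * w 0 (i + 1 + 1) - v 0 (i + 1 + 1) * w 0 (i + 1)).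

End Euclidean3.

Section SobolevUnitInterval.
Context {R : realType}.

(* Functions on I = (0, 1) are total functions on R whose values outside I
   (for Ycurves below, outside [0, 1]) play no role.  They represent their
   classes modulo equality almost everywhere on I. *)
Definition I01 : set R := `]0, 1[.

Definition test_function (phi : R -> R) : Prop :=
  (forall k t, derivable (derive1n k phi) t 1) /\
  exists K : set R, [/\ compact K, K `<=` I01 & forall t, ~ K t -> phi t = 0].

Definition weak_derivative (k : nat) (f g : R -> R) : Prop :=
  [/\ locally_integrable I01 f, locally_integrable I01 g &
    forall phi, test_function phi ->
      (\int[lebesgue_measure]_(t in I01) (f t * derive1n k phi t)%:E =
       ((-1) ^+ k)%:E * \int[lebesgue_measure]_(t in I01) (g t * phi t)%:E)%E].

(* A representative of the k-th weak derivative of f when there is one, and a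
   junk value otherwise. *)
Definition weakD (k : nat) (f : R -> R) : R -> R :=
  get [set g | weak_derivative k f g].

Definition Lp (p : R) : set (R -> R) :=
  [set f | (f \_ I01 : measurableTypeR R -> R) \in Lfun lebesgue_measure p%:E].

Definition Wkp (k : nat) (p : R) : set (R -> R) :=
  [set f | forall j, (j <= k)%N -> exists2 g, weak_derivative j f g & Lp p g].

Definition weakD3 (k : nat) (u : R -> 'rV[R]_3) : R -> 'rV[R]_3 :=
  fun t => \row_i weakD k (fun s => u s 0 i) t.

Definition Wkp3 (k : nat) (p : R) : set (R -> 'rV[R]_3) :=
  [set u | forall i, Wkp k p (fun t => u t 0 i)].

(* Meaningful on Wkp3 k p only, because of the junk values of weakD. *)
Definition Wkp3_norm (k : nat) (p : R) (u : R -> 'rV[R]_3) : \bar R :=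
  (\sum_(j < k.+1) 'N[lebesgue_measure]_(p%:E)
     [EFin \o ((fun t : measurableTypeR R => enorm (weakD3 j u t)) \_ I01)])%E.

End SobolevUnitInterval.

Section Curves.
Context {R : realType}.
Implicit Types (A B : 'rV[R]_3 * 'rV[R]_3) (u y : R -> 'rV[R]_3).

(* u is in C^oo([0, 1]): u is smooth in (0, 1), all its derivatives have limits
   at 0 and at 1, and u itself is continuous on [0, 1]. *)
Definition smooth01 u : Prop :=
  [/\ {within `[0, 1], continuous u},
      forall k t, I01 t -> derivable (derive1n k u) t 1,
      forall k, cvg (derive1n k u t @[t --> 0^'+]) &
      forall k, cvg (derive1n k u t @[t --> 1^'-])].

(* derive1 u 0 and derive1 u 1 would be two-sided derivatives, hence the limits. *)
Definition Ycurves A B : set (R -> 'rV[R]_3) :=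
  [set u | [/\ smooth01 u,
     u 0 = A.1 /\ derive1 u t @[t --> 0^'+] --> A.2,
     u 1 = B.1 /\ derive1 u t @[t --> 1^'-] --> B.2 &
     forall s, I01 s -> enorm (derive1 u s) = 1]].

Definition Ykm A B (km : R) : set (R -> 'rV[R]_3) :=
  [set u | Ycurves A B u /\ forall s, I01 s -> km <= enorm (derive1n 2 u s)].

Definition Xkmp A B (km p : R) : set (R -> 'rV[R]_3) :=
  [set u | Wkp3 3 p u /\
     forall e : R, 0 < e ->
       exists2 y, Ykm A B km y & (Wkp3_norm 3 p (u \- y)%R < e%:E)%E].

Definition W3p_cvg (p : R) (us : nat -> R -> 'rV[R]_3) u : Prop :=
  (Wkp3_norm 3 p (us j \- u)%R @[j --> \oo] --> 0)%E.

Definition lsc_on (p : R) (X : set (R -> 'rV[R]_3))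
    (G : (R -> 'rV[R]_3) -> R) : Prop :=
  forall u, X u -> forall e : R, 0 < e -> exists2 d : R, 0 < d &
    forall v, X v -> (Wkp3_norm 3 p (v \- u)%R < d%:E)%E -> G u - e < G v.

Definition curv u (t : R) : R := enorm (weakD3 2 u t).

Definition eta u (t : R) : R :=
  dot (weakD3 1 u t) (cross (weakD3 2 u t) (weakD3 3 u t)) /
  enorm (weakD3 2 u t) ^+ 3.

Definition Sadowsky u : \bar R :=
  (\int[lebesgue_measure]_(t in I01)
     (curv u t ^+ 2 * (1 + eta u t ^+ 2) ^+ 2)%:E)%E.

Definition gW (x : R) : \bar R :=
  if x == 0 then 1%E
  else if `|x| < 2 then (x^-1 * ln ((2 + x) / (2 - x)))%:E else +oo%E.

Definition Sadowsky_eps (eps : R) u : \bar R :=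
  if `[< Wkp 1 1 (eta u) >] then
    (\int[lebesgue_measure]_(t in I01)
       ((curv u t ^+ 2 * (1 + eta u t ^+ 2) ^+ 2)%:E *
        gW (eps * weakD 1 (eta u) t)))%E
  else +oo%E.

End Curves.

Definition is_Gamma_limit {R : realType} {T : Type} (X : set T)
    (conv : (nat -> T) -> T -> Prop) (Feps : R -> T -> \bar R)
    (F : T -> \bar R) : Prop :=
  forall eps : nat -> R, (forall j, 0 < eps j) ->
    eps j @[j --> \oo] --> (0 : R) ->
  forall u, X u ->
    (forall us : nat -> T, (forall j, X (us j)) -> conv us u ->
       (F u <= limn_einf (fun j => Feps (eps j) (us j)))%E) /\
    (exists us : nat -> T, [/\ forall j, X (us j), conv us u &
       (limn_esup (fun j => Feps (eps j) (us j)) <= F u)%E]).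

(* Main.v *)
(* The integrand kappa^2 (1 + eta^2)^2 is the fourth power of the length of the
   planar vector (sqrt kappa, sqrt kappa * eta), and with |u'| = 1 and
   kappa >= kappa_m its coordinates are Lipschitz in (u', u'', u''') up to a factor
   |u'''|.  As u''' is in L^4 (here p >= 4 enters), truncating |u'''| shows that
   the Sadowsky functional is continuous on X for the W^{3,p} norm; density of Y
   then gives the statement on G.  Since g >= 1, continuity also gives the liminf
   inequality.  On a smooth curve of Y, eta is Lipschitz, so that
   g(eps eta') -> 1 uniformly as eps -> 0, and a diagonal sequence of smooth
   curves converging to u is a recovery sequence.  Comparing weak derivatives
   with classical ones relies on the fundamental lemma of the calculus of
   variations, obtained from explicit bumps and Lebesgue differentiation. *)
Require Import Defs.
From HB Require Import structures.
From mathcomp Require Import all_boot all_order all_algebra.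
From mathcomp Require Import all_classical all_reals all_analysis.
From mathcomp Require Import measurable_realfun.
From mathcomp Require Import ring lra.

Set Implicit Arguments.
Unset Strict Implicit.
Unset Printing Implicit Defensive.
Import Order.TTheory GRing.Theory Num.Theory.
Import numFieldNormedType.Exports.

Local Open Scope classical_set_scope.
Local Open Scope ring_scope.

(** * Smooth bump functions *)

(** No Sobolev embedding is invoked: a curve of X is known only almost everywhere, and no upper
    bound on |u''| is available for it. All constants of the pointwise estimates therefore depend on
    the lower bound [km] alone, which is why the unit vector u''/|u''| and the negative powers of
    |u''| are kept apart. Two curves are compared multiplicatively, F(v) being at most (1 + s)^3
    F(u) plus a large multiple of an error; this replaces Minkowski's inequality in L^4 and makes
    sense before F is known to be finite on X. Finiteness on X is itself obtained from it, by
    comparison with one smooth curve. The error is asymmetric on purpose: the truncated tail belongs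
    to one of the two curves only, so that the distance required of the other one depends on nothing
    but the first. Since [weakD] selects a representative, even its additivity holds only almost
    everywhere, and every use of the norm of u - v rests on the uniqueness of weak derivatives. *)

Section Bump.
Context {R : realType}.

(** The powers of 1/x multiply the usual exp(-1/x) so that differentiation stays inside the family:
    the derivative of [psi m] is a combination of [psi m.+1] and [psi m.+2]. *)
Definition psi (m : nat) (x : R) : R :=
  if 0 < x then x^-1 ^+ m * expR (- x^-1) else 0.

Lemma psi_ge0 m x : 0 <= psi m x.
Proof.
rewrite /psi; case: ifPn => // x0.
by rewrite mulr_ge0 ?expR_ge0// exprn_ge0// invr_ge0 ltW.
Qed.

(** One term of the exponential series at 1/x, of degree m + 2, already dominates. The quadratic
    decay makes the difference quotient at 0 tend to 0. *)
Lemma psi_le m x : psi m x <= (m.+2)`!%:R * x ^+ 2.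
Proof.
rewrite /psi; case: ifPn => x0; last by rewrite mulr_ge0// sqr_ge0.
have xn : x != 0 by rewrite gt_eqF.
rewrite expRN ler_pdivrMr ?expR_gt0//.
have h := @expR_ge1Dxn R x^-1 m.+1 (ltW _); rewrite invr_gt0 in h.
have {h} : x^-1 ^+ m.+2 / m.+2`!%:R <= expR x^-1.
  by apply: le_trans (h x0); rewrite lerDr.
rewrite ler_pdivrMr ?ltr0n ?fact_gt0// => h.
rewrite -(ler_pM2l (exprn_gt0 2 x0)) in h.
suff <- : x ^+ 2 * x^-1 ^+ m.+2 = x^-1 ^+ m by apply: (le_trans h); rewrite le_eqVlt; apply/orP; left; apply/eqP; ring.
by rewrite -[m.+2]addn2 exprD mulrCA -exprMn divff// expr1n mulr1.
Qed.

Lemma is_derive_psi m (x : R) :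
  is_derive x 1 (psi m) (- m%:R * psi m.+1 x + psi m.+2 x).
Proof.
have [x0|x0|x0] := ltgtP x 0.
- apply: (@near_eq_is_derive _ _ _ (cst 0)) => //.
    near=> z; rewrite /psi ltNge ltW//.
    by near: z; exact: lt_nbhsl.
  rewrite /psi !ltNge !ltW//=.
  by apply: is_derive_eq; rewrite mulr0 addr0.
- have xn : x != 0 by rewrite gt_eqF.
  apply: (@near_eq_is_derive _ _ _ (fun t : R => t^-1 ^+ m * expR (- t^-1))) => //.
    near=> z; rewrite /psi ifT//.
    by near: z; exact: lt_nbhsr.
  have dV : is_derive x 1 (fun t : R => t^-1) (- x^-1 ^+ 2).
    apply: is_derive_eq; first exact: is_deriveV.
    by rewrite scaler1 exprVn.
  have dE : is_derive x 1 (fun t : R => expR (- t^-1)) (x^-1 ^+ 2 * expR (- x^-1)).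
    have := @is_derive1_comp _ expR (fun t : R => - t^-1) x _ _ (is_derive_expR _) (is_deriveN dV).
    by rewrite opprK mulrC.
  have dX := is_deriveX m dV; rewrite exprfctE in dX.
  rewrite /psi x0; apply: (is_derive_eq (is_deriveM dX dE)).
  rewrite /GRing.scale /=; clear dX; case: m => [|m] /=.
    by rewrite !mulr0n; ring.
  rewrite !exprS; ring.
- subst x.
  have h0 : h^-1 *: (psi m (h *: 1 + 0) - psi m 0) @[h --> (0:R)^'] --> (0 : R).
    apply/cvgrPdist_le => e e0; near=> h.
    have hn : h != 0 by near: h; exact: nbhs_dnbhs_neq.
    rewrite sub0r normrN /GRing.scale/= mulr1 addr0 {2}/psi ltxx subr0.
    rewrite normrM normfV ler_pdivrMl ?normr_gt0//.
    rewrite (ger0_norm (psi_ge0 _ _)) (le_trans (psi_le _ _))//.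
    rewrite -(real_normK (num_real h)) expr2 mulrCA ler_pM2l ?normr_gt0//.
    rewrite -ler_pdivlMl ?ltr0n ?fact_gt0//.
    near: h; apply: dnbhs0_le.
    by rewrite mulr_gt0// invr_gt0 ltr0n fact_gt0.
  have -> : - m%:R * psi m.+1 0 + psi m.+2 0 = 0 :> R.
    by rewrite /psi ltxx mulr0 addr0.
  apply: DeriveDef; first by apply: cvgP; exact: h0.
  exact: cvg_lim h0.
Unshelve. all: by end_near. Qed.

(* A class closed under differentiation, hence made of smooth functions. *)
Inductive bumpy : (R -> R) -> Prop :=
| bumpy_psi m c d : bumpy (fun t => psi m (c * t + d))
| bumpyD f g : bumpy f -> bumpy g -> bumpy (fun t => f t + g t)
| bumpyM f g : bumpy f -> bumpy g -> bumpy (fun t => f t * g t)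
| bumpyZ k f : bumpy f -> bumpy (fun t => k * f t).

Lemma bumpy_is_derive f : bumpy f ->
  exists2 g, bumpy g & forall t : R, is_derive t 1 f (g t).
Proof.
elim=> {f} [m c d|f g bf [f' bf' ff'] bg [g' bg' gg']|f g bf [f' bf' ff'] bg [g' bg' gg']|k f bf [f' bf' ff']].
- exists (fun t => c * (- m%:R * psi m.+1 (c * t + d) + psi m.+2 (c * t + d))).
    by apply: bumpyZ; apply: bumpyD; [apply: bumpyZ|]; exact: bumpy_psi.
  move=> t.
  have dl : is_derive t 1 (fun t : R => c * t + d) c.
    apply: (is_derive_eq (is_deriveD (is_deriveZ c (is_derive_id t 1)) (is_derive_cst d t 1))).
    by rewrite addr0 /GRing.scale/= mulr1.
  apply: (is_derive_eq (@is_derive1_comp _ (psi m) _ t _ _ (is_derive_psi m _) dl)).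
  by rewrite mulrC.
- exists (fun t => f' t + g' t); first exact: bumpyD.
  by move=> t; exact: is_deriveD.
- exists (fun t => f t * g' t + g t * f' t).
    by apply: bumpyD; exact: bumpyM.
  by move=> t; exact: is_deriveM.
- exists (fun t => k * f' t); first exact: bumpyZ.
  by move=> t; exact: is_deriveZ.
Qed.

Lemma bumpy_smooth f : bumpy f -> forall k t, derivable (derive1n k f) t 1.
Proof.
move=> bf k.
have : bumpy (derive1n k f).
  elim: k => // k /bumpy_is_derive[g bg fg]; rewrite derive1nS.
  suff -> : (derive1n k f)^`()%classic = g by [].
  by apply/funext => t; rewrite derive1E; exact: derive_val.
by move=> /bumpy_is_derive[g bg fg] t; have [] := fg t.
Qed.

(* The (n + 1)-th root of one bump on (a, b), hence increasing to 1 there. *)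
Definition smooth_bump (a b : R) (n : nat) (t : R) : R :=
  psi 0 (n.+1%:R * t + - (n.+1%:R * a)) * psi 0 (- n.+1%:R * t + n.+1%:R * b).

Lemma smooth_bump_out a b n t : ~ (a < t < b) -> smooth_bump a b n t = 0.
Proof.
move=> h; rewrite /smooth_bump /psi -mulrN -mulrDr mulNr [- _ + _]addrC -mulrBr.
rewrite !pmulr_rgt0// !subr_gt0.
by case: ltP => h1; case: ltP => h2; rewrite ?mulr0 ?mul0r//; case: h; rewrite h1 h2.
Qed.

Lemma psi0_le1 x : psi 0 x <= 1.
Proof.
rewrite /psi; case: ifPn => // x0.
by rewrite expr0 mul1r expR_le1 oppr_le0 invr_ge0 ltW.
Qed.

Lemma smooth_bump_ge0 a b n t : 0 <= smooth_bump a b n t.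
Proof. by rewrite mulr_ge0// psi_ge0. Qed.

Lemma smooth_bump_le1 a b n t : smooth_bump a b n t <= 1.
Proof. by rewrite mulr_ile1 ?psi_ge0 ?psi0_le1. Qed.

Lemma smooth_bump_cvg a b t : a < t < b -> smooth_bump a b n t @[n --> \oo] --> (1 : R).
Proof.
move=> /andP[at_ tb].
have key x : 0 < x -> psi 0 (n.+1%:R * x) @[n --> \oo] --> (1 : R).
  move=> x0.
  have -> : (fun n : nat => psi 0 (n.+1%:R * x)) = (fun n => expR (- (x^-1 * n.+1%:R^-1))).
    by apply/funext => n; rewrite /psi mulr_gt0// expr0 mul1r invfM mulrC.
  rewrite -[X in _ --> X](@expR0 R); apply: continuous_cvg; first exact: continuous_expR.
  rewrite -[X in _ --> X]oppr0; apply: cvgN.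
  rewrite -[X in _ --> X](mulr0 x^-1); apply: cvgM; first exact: cvg_cst.
  exact: cvg_harmonic.
rewrite -[X in _ --> X]mulr1; apply: cvgM.
  under eq_fun do rewrite -mulrBr.
  by apply: key; rewrite subr_gt0.
under eq_fun do rewrite mulNr addrC -mulrBr.
by apply: key; rewrite subr_gt0.
Qed.

Lemma smooth_bump_test a b n : 0 < a -> b < 1 -> test_function (smooth_bump a b n).
Proof.
move=> a0 b1; split.
  by apply: bumpy_smooth; apply: bumpyM; exact: bumpy_psi.
exists `[a, b]%classic; split; first exact: segment_compact.
  move=> t /=; rewrite !in_itv/= => /andP[at_ tb].
  by rewrite /I01 /= in_itv/= (lt_le_trans a0)// (le_lt_trans tb).
move=> t ht; apply: smooth_bump_out => /andP[h1 h2]; apply: ht.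
by rewrite /= in_itv/= !ltW.
Qed.

End Bump.

(** * Uniqueness of weak derivatives *)

Section WeakUniqueness.
Context {R : realType}.
Notation mu := (@lebesgue_measure R).
Implicit Types f g phi : R -> R.

Lemma I01E (t : R) : I01 t <-> 0 < t < 1.
Proof. by rewrite /I01/= in_itv. Qed.

Lemma measurable_I01 : measurable (@I01 R : set (measurableTypeR R)).
Proof. exact: measurable_itv. Qed.

Lemma open_I01 : open (@I01 R).
Proof. exact: itv_open. Qed.

Lemma ae_impl (P Q : R -> Prop) : (forall t, P t -> Q t) ->
  {ae mu, forall t, P t} -> {ae mu, forall t, Q t}.
Proof. by move=> PQ; apply: filterS; first exact: (ae_filter_ringOfSetsType mu). Qed.

Lemma ae_impl2 (P P' Q : R -> Prop) : (forall t, P t -> P' t -> Q t) ->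
  {ae mu, forall t, P t} -> {ae mu, forall t, P' t} -> {ae mu, forall t, Q t}.
Proof. by move=> PQ; apply: filterS2; first exact: (ae_filter_ringOfSetsType mu). Qed.

Lemma test_continuous phi : test_function phi -> continuous phi.
Proof.
move=> [d _] t; apply: differentiable_continuous.
by apply/derivable1_diffP; exact: (d 0%N).
Qed.

Lemma test_derive1 phi : test_function phi -> test_function (derive1 phi).
Proof.
move=> [d [K [cK KI K0]]]; split.
  by move=> k t; rewrite -derive1Sn; exact: d.
exists K; split => // t Kt.
have oK : open (~` K).
  by apply: closed_openC; apply: compact_closed => //; exact: Rhausdorff.
rewrite derive1E (_ : 0 = 'D_1 (cst (0 : R)) t); last by rewrite derive_cst.
apply: near_eq_derive.
have := open_nbhs_nbhs (conj oK Kt).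
by apply: filterS => z /K0.
Qed.

Lemma test_derive1n k phi : test_function phi -> test_function (derive1n k phi).
Proof. by move=> tphi; elim: k => // k; rewrite derive1nS; exact: test_derive1. Qed.

Lemma measurable_test phi (D : set R) : test_function phi ->
  measurable (D : set (measurableTypeR R)) -> measurable_fun (D : set (measurableTypeR R)) phi.
Proof.
move=> tphi mD; apply: measurable_funTS; apply: continuous_measurable_fun.
exact: test_continuous.
Qed.

Lemma test_bounded phi : test_function phi -> exists M, forall t, `|phi t| <= M.
Proof.
move=> tphi; have [_ [K [cK KI K0]]] := tphi.
have : compact (phi @` K).
  apply: continuous_compact => //; apply: continuous_subspaceT.
  exact: test_continuous.
move=> /compact_bounded [M [_ hM]]; exists (`|M| + 1) => t.
have [Kt|Kt] := pselect (K t).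
  by apply: (hM (`|M| + 1)); [rewrite ltr_pwDr// ler_norm|exists t].
by rewrite K0// normr0 addr_ge0.
Qed.

Lemma integrable_test g phi : locally_integrable I01 g -> test_function phi ->
  mu.-integrable I01 (fun t => (g t * phi t)%:E).
Proof.
move=> [mg oI ig] tphi; have [M hM] := test_bounded tphi.
have [_ [K [cK KI K0]]] := tphi.
have mK : measurable (K : set (measurableTypeR R)) by exact: compact_measurable.
have mgK : measurable_fun K g by apply: measurable_funS mg => //; exact: measurable_I01.
apply/integrableP; split.
  apply/measurable_EFinP; apply: measurable_funM => //.
  by apply: measurable_test => //; exact: measurable_I01.
(* [g] need not be integrable up to the ends of the interval, so the integral is first reduced to
   the compact [K] outside which [phi] vanishes. *)
rewrite (_ : (\int[mu]_(x in I01) `|(g x * phi x)%:E| = \int[mu]_(x in K) `|(g x * phi x)%:E|)%E).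
  apply: (@le_lt_trans _ _ (\int[mu]_(x in K) (`|M|%:E * `|(g x)%:E|))%E).
    apply: ge0_le_integral => //.
    - apply/measurableT_comp => //; apply/measurable_EFinP; apply: measurable_funM => //.
      exact: measurable_test.
    - by apply: measurable_funeM; apply/measurableT_comp => //; exact/measurable_EFinP.
    - move=> x _; rewrite -!abse_EFin -EFinM lee_fin normrM mulrC ler_wpM2r//.
      by rewrite (le_trans (hM x))// ler_norm.
  rewrite ge0_integralZl_EFin//.
    by rewrite lte_mul_pinfty// ig.
  by apply/measurableT_comp => //; exact/measurable_EFinP.
rewrite integral_mkcond [RHS]integral_mkcond; apply: eq_integral => x _.
rewrite !patchE; case: ifPn; case: ifPn => //.
- by rewrite notin_setE => Kx _; rewrite K0// mulr0 /= normr0.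
- by rewrite inE notin_setE => /KI.
Qed.

(** The bumps tend to 1 on the open interval and vanish off it, and |g|, integrable on the compact
    [a, b], dominates the products; dominated convergence then carries the vanishing over to the
    interval. *)
Lemma integral_of_test g (a b : R) : locally_integrable I01 g ->
  (forall phi, test_function phi -> (\int[mu]_(t in I01) (g t * phi t)%:E = 0)%E) ->
  0 < a -> b < 1 -> (\int[mu]_(t in `[a, b]) (g t)%:E = 0)%E.
Proof.
move=> [mg oI ig] g0 a0 b1.
have sub : `[a, b] `<=` I01.
  move=> t /=; rewrite in_itv/= => /andP[h1 h2]; apply/I01E.
  by rewrite (lt_le_trans a0)// (le_lt_trans h2).
have sub' : `]a, b[ `<=` I01 by apply: subset_trans sub; exact: subset_itv_oo_cc.
have mgo : measurable_fun `]a, b[ g by apply: measurable_funS mg => //; exact: measurable_I01.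
rewrite integral_itv_bndoo; last exact/measurable_EFinP.
have int : mu.-integrable `]a, b[ (EFin \o g).
  have intc : mu.-integrable `[a, b] (EFin \o g).
    apply/integrableP; split; last by apply: ig => //; exact: segment_compact.
    by apply/measurable_EFinP; apply: measurable_funS mg => //; exact: measurable_I01.
  by apply: integrableS intc => //; exact: subset_itv_oo_cc.
have tb n := smooth_bump_test n a0 b1.
have mf_ n : measurable_fun `]a, b[ (fun t => (g t * smooth_bump a b n t)%:E).
  apply/measurable_EFinP; apply: measurable_funM => //.
  by apply: measurable_test.
have mf : measurable_fun `]a, b[ (EFin \o g) by exact/measurable_EFinP.
have cv : {ae mu, forall x, `]a, b[%classic x ->
    (fun n => (g x * smooth_bump a b n x)%:E) @ \oo --> (EFin \o g) x}.
  apply: aeW => x; rewrite /= in_itv/= => xab.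
  apply: cvg_EFin; first by apply: nearW.
  rewrite -[X in _ --> X]mulr1; apply: cvgM; first exact: cvg_cst.
  exact: smooth_bump_cvg.
have dom : {ae mu, forall x (n : nat), `]a, b[%classic x ->
    (`|(g x * smooth_bump a b n x)%:E| <= (abse \o (EFin \o g)) x)%E}.
  apply: aeW => x n _; rewrite /= lee_fin normrM ler_piMr//.
  by rewrite ger0_norm ?smooth_bump_ge0 ?smooth_bump_le1.
have [_ _] := @dominated_convergence _ _ _ mu _ (measurable_itv _) _ _ _ mf_ mf cv (integrable_abse int) dom.
have -> : [sequence (\int[mu]_(x in `]a, b[) (g x * smooth_bump a b n x)%:E)%E]_n = cst 0%E.
  apply/funext => n /=; rewrite -[RHS](g0 _ (tb n)).
  rewrite integral_mkcond [RHS]integral_mkcond; apply: eq_integral => x _.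
  rewrite !patchE; case: ifPn; case: ifPn => //.
  - by rewrite notin_setE inE => + /sub'.
  - rewrite notin_setE/= in_itv/= => _ h; rewrite smooth_bump_out ?mulr0//.
by move=> /(cvg_lim (@ereal_hausdorff _)) <-; rewrite lim_cst.
Qed.


(** The primitive of [g] from d vanishes by [integral_of_test], hence so does its derivative, which
    is [g] almost everywhere by Lebesgue differentiation. *)
Lemma eq0_of_test_itv g (d : R) : 0 < d -> locally_integrable I01 g ->
  (forall phi, test_function phi -> (\int[mu]_(t in I01) (g t * phi t)%:E = 0)%E) ->
  {ae mu, forall t, d < t < 1 - d -> g t = 0}.
Proof.
move=> d0 lg g0; have [mg oI ig] := lg.
have b1 : 1 - d < 1 by rewrite ltrBlDr ltrDl.
(* The cut-off makes the function integrable on the whole line, so that its primitive can start at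
   minus infinity. *)
pose f := g \_ `[d, 1 - d].
have sub : `[d, 1 - d] `<=` I01.
  move=> t /=; rewrite in_itv/= => /andP[h1 h2]; apply/I01E.
  by rewrite (lt_le_trans d0)// (le_lt_trans h2).
have intg : mu.-integrable `[d, 1 - d] (EFin \o g).
  apply/integrableP; split; last by apply: ig => //; exact: segment_compact.
  by apply/measurable_EFinP; apply: measurable_funS mg => //; exact: measurable_I01.
have intf : mu.-integrable setT (EFin \o f).
  by rewrite /f -restrict_EFin -integrable_mkcond.
have lf : locally_integrable setT f by apply: open_integrable_locally => //; exact: openT.
have intfy y : mu.-integrable `]-oo, y] (EFin \o f) by apply: integrableS intf.
have := FTC1Ny intfy lf.
apply: ae_impl.
move=> t [_ Ht] /andP[dt td].
have -> : g t = f t by rewrite /f patchE mem_set//= in_itv/= !ltW.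
rewrite -Ht derive1E (_ : 0 = 'D_1 (cst (0 : R)) t); last by rewrite derive_cst.
apply: near_eq_derive; near=> z.
have z1 : z < 1 - d by near: z; exact: lt_nbhsl.
rewrite /Rintegral/= [X in fine X](_ : _ = 0%E)//.
rewrite -(@integral_of_test g d z lg g0 d0); last exact: lt_trans b1.
rewrite integral_mkcond [RHS]integral_mkcond; apply: eq_integral => x _.
rewrite /f !patchE.
have -> : (x \in `]-oo, z]%classic) = (x <= z) by rewrite mem_setE in_itv.
have -> : (x \in `[d, z]%classic) = (d <= x) && (x <= z) by rewrite mem_setE in_itv.
have -> : (x \in `[d, 1 - d]%classic) = (d <= x) && (x <= 1 - d) by rewrite mem_setE in_itv.
case: (leP x z) => xz; rewrite ?andbF ?andbT//.
by rewrite (le_trans xz (ltW z1)) andbT; case: ifP.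
Unshelve. all: by end_near. Qed.

Lemma eq0_of_test g : locally_integrable I01 g ->
  (forall phi, test_function phi -> (\int[mu]_(t in I01) (g t * phi t)%:E = 0)%E) ->
  {ae mu, forall t, I01 t -> g t = 0}.
Proof.
move=> lg g0.
have := ae_foralln (fun n : nat => @eq0_of_test_itv g n.+1%:R^-1 (ltac:(by rewrite invr_gt0)) lg g0).
apply: ae_impl.
move=> t H /I01E /andP[t0 t1].
have m0 : 0 < Num.min t (1 - t) by rewrite lt_min t0 subr_gt0.
have [n] := ltr_add_invr m0; rewrite add0r lt_min => /andP[h1 h2].
by apply: (H n); rewrite h1/= ltrBrDr addrC -ltrBrDr.
Qed.

Lemma integral_testB g1 g2 phi :
  locally_integrable I01 g1 -> locally_integrable I01 g2 -> test_function phi ->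
  (\int[mu]_(t in I01) ((g1 \- g2)%R t * phi t)%:E =
   \int[mu]_(t in I01) (g1 t * phi t)%:E - \int[mu]_(t in I01) (g2 t * phi t)%:E)%E.
Proof.
move=> l1 l2 tphi; rewrite -integralB//; last 3 first.
- exact: measurable_I01.
- exact: integrable_test.
- exact: integrable_test.
by apply: eq_integral => t _; rewrite /= mulrBl EFinB.
Qed.

Lemma sign_mule_inj k (x y : \bar R) :
  (((-1) ^+ k)%:E * x = ((-1) ^+ k)%:E * y -> x = y)%E.
Proof.
move=> /(congr1 (fun z => ((-1) ^+ k)%:E * z)%E).
by rewrite !muleA -EFinM -expr2 sqrr_sign !mul1e.
Qed.

Lemma weak_derivative_unique k f g1 g2 :
  weak_derivative k f g1 -> weak_derivative k f g2 ->
  {ae mu, forall t, I01 t -> g1 t = g2 t}.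
Proof.
move=> [_ l1 h1] [_ l2 h2].
have := @eq0_of_test (g1 \- g2)%R (locally_integrableB l1 l2) _.
have h phi : test_function phi ->
    (\int[mu]_(t in I01) ((g1 \- g2)%R t * phi t)%:E = 0)%E.
  move=> tphi; rewrite integral_testB//.
  rewrite (@sign_mule_inj k _ _ (etrans (esym (h1 _ tphi)) (h2 _ tphi))).
  rewrite subee//; apply: integrable_fin_num; first exact: measurable_I01.
  exact: integrable_test.
move=> /(_ h); apply: ae_impl.
by move=> t /[apply] /eqP; rewrite subr_eq0 => /eqP.
Qed.

Lemma weak_derivativeB k f1 f2 g1 g2 :
  weak_derivative k f1 g1 -> weak_derivative k f2 g2 ->
  weak_derivative k (f1 \- f2)%R (g1 \- g2)%R.
Proof.
move=> [m1 l1 h1] [m2 l2 h2]; split; [exact: locally_integrableB..|].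
move=> phi tphi; rewrite !integral_testB//; last exact: test_derive1n.
have fin g : locally_integrable I01 g ->
    (\int[mu]_(t in I01) (g t * phi t)%:E)%E \is a fin_num.
  by move=> lg; apply: integrable_fin_num; [exact: measurable_I01|exact: integrable_test].
rewrite h1// h2// -(fineK (fin _ l1)) -(fineK (fin _ l2)).
exact: (congr1 EFin (esym (mulrBr _ _ _))).
Qed.

Lemma ae_eq_integral_I01 f f' : measurable_fun I01 f -> measurable_fun I01 f' ->
  {ae mu, forall t, I01 t -> f t = f' t} ->
  (\int[mu]_(t in I01) (f t)%:E = \int[mu]_(t in I01) (f' t)%:E)%E.
Proof.
move=> mf mf' ff'; apply: ae_eq_integral.
- exact: measurable_I01.
- exact/measurable_EFinP.
- exact/measurable_EFinP.
move: ff'; apply: ae_impl.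
by move=> t h /h ->.
Qed.

(** Meant for [eta], which is built from selected weak derivatives and agrees with its classical
    formula only almost everywhere. *)
Lemma ae_eq_weak_derivative k f f' g g' :
  locally_integrable I01 f' -> locally_integrable I01 g' ->
  {ae mu, forall t, I01 t -> f t = f' t} -> {ae mu, forall t, I01 t -> g t = g' t} ->
  weak_derivative k f g -> weak_derivative k f' g'.
Proof.
have key u v phi : locally_integrable I01 u -> locally_integrable I01 v ->
    {ae mu, forall t, I01 t -> u t = v t} -> test_function phi ->
    (\int[mu]_(t in I01) (u t * phi t)%:E = \int[mu]_(t in I01) (v t * phi t)%:E)%E.
  move=> [mu_ _ _] [mv _ _] uv tphi.
  have mphi : measurable_fun I01 phi by apply: measurable_test => //; exact: measurable_I01.
  apply: ae_eq_integral_I01; [exact: measurable_funM..|].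
  move: uv; apply: ae_impl.
  by move=> t h /h ->.
move=> lf' lg' ff' gg' [lf lg h]; split => // phi tphi.
rewrite -(key f)//; last exact: test_derive1n.
by rewrite -(key g g')// h.
Qed.

Lemma weakDP k f g : weak_derivative k f g -> weak_derivative k f (weakD k f).
Proof. by move=> h; apply: (@getPex _ [set g | weak_derivative k f g]); exists g. Qed.

(** This is the only access to the values of [weakD], so pointwise facts about it are stated almost
    everywhere from here on. *)
Lemma weakD_ae k f g : weak_derivative k f g ->
  {ae mu, forall t, I01 t -> weakD k f t = g t}.
Proof. by move=> h; apply: weak_derivative_unique (weakDP h) h. Qed.

End WeakUniqueness.

(** * Classical derivatives as weak derivatives *)

Section BoundedC1.
Context {R : realType}.
Notation mu := (@lebesgue_measure R).
Implicit Types f g phi : R -> R.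

Definition bdd f := exists M, forall t, I01 t -> `|f t| <= M.

(** The derivative is carried along with the function. Boundedness gives local integrability and
    membership in every L^p, and is stable under products and, given a positive lower bound, under
    inverses and square roots. *)
Definition c1b f g := [/\ forall t, I01 t -> is_derive t 1 f (g t),
  forall t, I01 t -> {for t, continuous g}, bdd f & bdd g].

Lemma near_I01 (t : R) : I01 t -> \forall s \near t, I01 s.
Proof. by move=> It; apply: open_nbhs_nbhs; split => //; exact: open_I01. Qed.

Lemma bddD f g : bdd f -> bdd g -> bdd (fun t => f t + g t).
Proof.
move=> [M hM] [N hN]; exists (M + N) => t It.
by rewrite (le_trans (ler_normD _ _))// lerD ?hM ?hN.
Qed.

Lemma bddM f g : bdd f -> bdd g -> bdd (fun t => f t * g t).
Proof.
move=> [M hM] [N hN]; exists (M * N) => t It.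
by rewrite normrM ler_pM ?hM ?hN.
Qed.

Lemma is_derive_continuous f (t d : R) : is_derive t 1 f d -> {for t, continuous f}.
Proof.
by move=> [h _]; apply: differentiable_continuous; exact/derivable1_diffP.
Qed.

Lemma c1b_continuous f g : c1b f g -> forall t, I01 t -> {for t, continuous f}.
Proof. by move=> [h _ _ _] t /h; exact: is_derive_continuous. Qed.

Lemma c1b_ext f f' g : (forall t, I01 t -> f t = f' t) -> c1b f g -> c1b f' g.
Proof.
move=> ff' [dfg cg bf bg]; split => //.
  move=> t It; apply: near_eq_is_derive (dfg _ It).
  by apply: filterS (near_I01 It) => s; exact: ff'.
by have [M hM] := bf; exists M => t It; rewrite -ff'// hM.
Qed.

Lemma c1bD f g f' g' : c1b f f' -> c1b g g' ->
  c1b (fun t => f t + g t) (fun t => f' t + g' t).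
Proof.
move=> [d1 c1 b1 e1] [d2 c2 b2 e2]; split; [| |exact: bddD..].
- by move=> t It; apply: is_deriveD; [exact: d1|exact: d2].
- by move=> t It; apply: cvgD; [exact: c1|exact: c2].
Qed.

Lemma c1bM f g f' g' : c1b f f' -> c1b g g' ->
  c1b (fun t => f t * g t) (fun t => f t * g' t + g t * f' t).
Proof.
move=> h1 h2; have [d1 c1 b1 e1] := h1; have [d2 c2 b2 e2] := h2; split.
- by move=> t It; apply: is_deriveM; [exact: d1|exact: d2].
- move=> t It; apply: cvgD; apply: cvgM; [|exact: c2| |exact: c1].
    exact: (c1b_continuous h1 It).
  exact: (c1b_continuous h2 It).
- exact: bddM.
- by apply: bddD; exact: bddM.
Qed.

Lemma c1bN f f' : c1b f f' -> c1b (fun t => - f t) (fun t => - f' t).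
Proof.
move=> [d1 c1 b1 e1]; split.
- by move=> t It; apply: is_deriveN; exact: d1.
- by move=> t It; apply: cvgN; exact: c1.
- by have [M hM] := b1; exists M => t It; rewrite normrN hM.
- by have [M hM] := e1; exists M => t It; rewrite normrN hM.
Qed.

Lemma c1bV f f' (c : R) : 0 < c -> (forall t, I01 t -> c <= f t) -> c1b f f' ->
  c1b (fun t => (f t)^-1) (fun t => - (f t)^-1 ^+ 2 * f' t).
Proof.
move=> c0 cf h; have [d1 c1 b1 e1] := h.
have f0 t : I01 t -> 0 < f t by move=> /cf; exact: lt_le_trans.
have bV : bdd (fun t => (f t)^-1).
  exists c^-1 => t It; rewrite ger0_norm ?invr_ge0 ?(ltW (f0 _ It))//.
  by rewrite lef_pV2 ?posrE ?f0// cf.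
split => //.
- move=> t It; apply: (is_derive_eq (is_deriveV _ (d1 _ It))).
    by rewrite gt_eqF// f0.
  by rewrite exprVn.
- move=> t It; apply: cvgM; last exact: c1.
  apply: cvgN; rewrite expr2; under eq_fun do rewrite expr2.
  have := c1b_continuous h It => cf'.
  by apply: cvgM; apply: cvgV => //; rewrite gt_eqF// f0.
- apply: bddM => //.
  have [M hM] := bddM bV bV; exists M => t It.
  by rewrite normrN expr2 hM.
Qed.

Lemma c1b_sqrt f f' (c : R) : 0 < c -> (forall t, I01 t -> c <= f t) -> c1b f f' ->
  c1b (fun t => Num.sqrt (f t)) (fun t => (2 * Num.sqrt (f t))^-1 * f' t).
Proof.
move=> c0 cf h; have [d1 c1 b1 e1] := h.
have f0 t : I01 t -> 0 < f t by move=> /cf; exact: lt_le_trans.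
split.
- move=> t It; apply: (is_derive_eq (is_derive1_comp (is_derive1_sqrt (f0 _ It)) (d1 _ It))).
  by [].
- move=> t It; apply: cvgM; last exact: c1.
  apply: cvgV; first by rewrite mulf_neq0// gt_eqF// sqrtr_gt0 f0.
  apply: cvgM; first exact: cvg_cst.
  apply: continuous_comp; first exact: (c1b_continuous h It).
  exact: sqrt_continuous.
- have [M hM] := b1; exists (Num.sqrt M) => t It.
  rewrite ger0_norm ?sqrtr_ge0// ler_wsqrtr//.
  by rewrite (le_trans (ler_norm _))// hM.
- apply: bddM => //; exists (2 * Num.sqrt c)^-1 => t It.
  have s0 : 0 < Num.sqrt c by rewrite sqrtr_gt0.
  have s1 : 0 < Num.sqrt (f t) by rewrite sqrtr_gt0 f0.
  rewrite ger0_norm ?invr_ge0 ?mulr_ge0 ?(ltW s1)//.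
  by rewrite lef_pV2 ?posrE ?mulr_gt0// ler_pM2l// ler_wsqrtr// cf.
Qed.

Lemma measurable_continuous_I01 f : (forall t, I01 t -> {for t, continuous f}) ->
  measurable_fun I01 f.
Proof.
move=> cf; apply: subspace_continuous_measurable_fun; first exact: measurable_I01.
by apply: continuous_in_subspaceT => t; rewrite inE => /cf.
Qed.

Lemma mu_I01 : mu I01 = 1%E.
Proof. by rewrite /I01 lebesgue_measure_itv/= lte_fin ltr01 oppr0 adde0. Qed.

Lemma integrable_bdd f : measurable_fun I01 f -> bdd f -> mu.-integrable I01 (EFin \o f).
Proof.
move=> mf [M hM]; apply: measurable_bounded_integrable => //.
- exact: measurable_I01.
- by have h := ltry (1 : R); rewrite -mu_I01 in h; exact: h.
- exists M; split; first exact: num_real.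
  by move=> x Mx y Iy; rewrite /= (le_trans (hM _ Iy))// ltW.
Qed.

Lemma locally_integrable_bdd f : measurable_fun I01 f -> bdd f -> locally_integrable I01 f.
Proof.
move=> mf bf; apply: open_integrable_locally; first exact: open_I01.
exact: integrable_bdd.
Qed.

Lemma c1b_loc f g : c1b f g -> locally_integrable I01 f.
Proof.
move=> h; have [_ _ b _] := h; apply: locally_integrable_bdd => //.
apply: measurable_continuous_I01; exact: (c1b_continuous h).
Qed.

Lemma c1b_loc' f g : c1b f g -> locally_integrable I01 g.
Proof.
move=> h; have [_ c _ b] := h; apply: locally_integrable_bdd => //.
exact: measurable_continuous_I01.
Qed.

Lemma test_parts f g phi : c1b f g -> test_function phi ->
  (\int[mu]_(t in I01) (f t * derive1 phi t)%:E =
   - \int[mu]_(t in I01) (g t * phi t)%:E)%E.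
Proof.
move=> fg tphi; have [df cg bf bg] := fg.
have tphi' := test_derive1 tphi.
(* The compact set provided for [derive1 phi] need not be the one provided for [phi]. *)
have [dphi [K [cK KI K0]]] := tphi; have [_ [K' [cK' K'I K'0]]] := tphi'.
(* h is differentiable on the whole line since phi vanishes near 0 and 1. *)
pose h t := f t * phi t; pose h' t := f t * derive1 phi t + phi t * g t.
have oK : open (~` K).
  by apply: closed_openC; apply: compact_closed => //; exact: Rhausdorff.
have oK' : open (~` K').
  by apply: closed_openC; apply: compact_closed => //; exact: Rhausdorff.
have dphi1 (t : R) : is_derive t 1 phi (derive1 phi t).
  by rewrite derive1E; apply: derivableP; exact: (dphi 0%N).
have dh (t : R) : is_derive t 1 h (h' t).
  have [It|It] := pselect (I01 t); first by apply: is_deriveM => //; exact: df.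
  have Kt : ~ K t by move=> /KI.
  have -> : h' t = 0.
    rewrite /h' (K0 _ Kt) mul0r K'0 ?mulr0 ?addr0//.
    by move=> /K'I.
  apply: (@near_eq_is_derive _ _ _ (cst (0 : R))) => //.
  have := open_nbhs_nbhs (conj oK Kt).
  by apply: filterS => z /K0; rewrite /h => ->; rewrite mulr0.
have ch' : continuous h'.
  move=> t.
  have [It|It] := pselect (I01 t).
    apply: cvgD; apply: cvgM.
    - exact: (c1b_continuous fg It).
    - exact: test_continuous.
    - exact: test_continuous.
    - exact: cg.
  have Kt : ~ K t by move=> /KI.
  have K't : ~ K' t by move=> /K'I.
  have : \forall s \near t, 0 = h' s.
    near=> s; rewrite /h' K0 ?mul0r ?addr0; last first.
      by near: s; have := open_nbhs_nbhs (conj oK Kt).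
    rewrite K'0 ?mulr0//.
    by near: s; have := open_nbhs_nbhs (conj oK' K't).
  move=> H; rewrite /continuous_at -(nbhs_singleton H).
  by apply: cvg_near_cst; apply: filterS H => s <-.
have ftc : (\int[mu]_(x in `[0%R, 1%R]) (h' x)%:E = (h 1)%:E - (h 0)%:E)%E.
  have ch : continuous h by move=> t; exact: is_derive_continuous (dh t).
  apply: continuous_FTC2 => //.
  - exact: continuous_subspaceT.
  - split.
    + by move=> x _; have [] := dh x.
    + exact: cvg_at_right_filter (ch 0).
    + exact: cvg_at_left_filter (ch 1).
  - by move=> x _; rewrite derive1E; exact: derive_val.
have Kend t : ~ (0 < t < 1) -> phi t = 0 by move=> Ht; apply: K0 => /KI /I01E.
move: ftc; rewrite /h !Kend ?ltxx ?andbF// !mulr0 subee//.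
rewrite integral_itv_bndoo; last first.
  apply/measurable_EFinP; apply: measurable_funTS.
  exact: continuous_measurable_fun.
rewrite -/I01 /h'; under eq_integral do rewrite EFinD.
rewrite integralD; last 3 first.
- exact: measurable_I01.
- by apply: integrable_test => //; exact: c1b_loc fg.
- under eq_fun do rewrite mulrC.
  by apply: integrable_test => //; exact: c1b_loc' fg.
under [in X in (_ + X)%E]eq_integral do rewrite mulrC.
have fin g1 phi1 : locally_integrable I01 g1 -> test_function phi1 ->
    (\int[mu]_(t in I01) (g1 t * phi1 t)%:E)%E \is a fin_num.
  by move=> l1 t1; apply: integrable_fin_num; [exact: measurable_I01|exact: integrable_test].
have := fin _ _ (c1b_loc' fg) tphi; have := fin _ _ (c1b_loc fg) tphi'.
move=> /fineK <- /fineK <-; rewrite -EFinD -EFinN => -[] /eqP.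
by rewrite addr_eq0 => /eqP ->.
Unshelve. all: by end_near. Qed.

(** The induction generalizes over [phi]: its innermost derivative is peeled off, the hypothesis is
    applied to [derive1 phi], and one integration by parts moves the remaining derivative onto
    [F k]. *)
Lemma weak_derivative_c1b (F : nat -> R -> R) k :
  (forall j, c1b (F j) (F j.+1)) -> weak_derivative k (F 0%N) (F k).
Proof.
move=> hF; split; [exact: c1b_loc (hF _)..|].
elim: k => [|k IH] phi tphi; first by rewrite expr0 mul1e.
rewrite derive1Sn IH; last exact: test_derive1.
by rewrite (test_parts (hF k) tphi) exprS mulN1r EFinN muleN mulNe.
Qed.

Lemma weak_derivative0_c1b f g : c1b f g -> weak_derivative 0 f f.
Proof. by move=> h; split; [exact: c1b_loc h..|] => phi _; rewrite expr0 mul1e. Qed.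

Lemma weak_derivative1_c1b f g : c1b f g -> weak_derivative 1 f g.
Proof.
move=> h; split; [exact: c1b_loc h|exact: c1b_loc' h|] => phi tphi.
by rewrite (test_parts h tphi) expr1 EFinN mulNe mul1e.
Qed.

End BoundedC1.

(** * Membership in L^p on the unit interval *)

Section LpI01.
Context {R : realType}.
Notation mu := (@lebesgue_measure R).
Implicit Types f : R -> R.

Lemma Lnorm_I01 (p : R) f : p != 0 ->
  (('N[mu]_(p%:E)[EFin \o (f \_ I01)]) `^ p = \int[mu]_(t in I01) (`|f t| `^ p)%:E)%E.
Proof.
move=> p0; rewrite (poweR_Lnorm _ _ p0) [RHS]integral_mkcond; apply: eq_integral => t _.
by rewrite /= !patchE; case: ifP => _; rewrite ?normr0 ?(powR0 p0).
Qed.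

Lemma measurable_fun_Lp p f : Lp p f -> measurable_fun I01 f.
Proof.
rewrite /Lp /= inE => /andP[/[!inE]/= mf _].
by apply/(measurable_restrictT _ _).2 => //; exact: measurable_I01.
Qed.

Lemma LpP p f : 0 < p -> Lp p f <->
  measurable_fun I01 f /\ (\int[mu]_(t in I01) (`|f t| `^ p)%:E < +oo)%E.
Proof.
move=> p0; split.
  move=> h; split; first exact: measurable_fun_Lp h.
  move: h; rewrite /Lp /= inE => /andP[_ /[!inE]/= h].
  by rewrite -Lnorm_I01 ?gt_eqF//; exact: poweR_lty.
move=> [mf fp]; rewrite /Lp /= inE; apply/andP; split; rewrite inE /=.
  by apply/(measurable_restrictT _ _).1 => //; exact: measurable_I01.
rewrite /finite_norm; apply: (@lty_poweRy _ _ p); first by rewrite gt_eqF.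
by rewrite Lnorm_I01 ?gt_eqF.
Qed.

Lemma Lp_bdd p f : 0 < p -> measurable_fun I01 f -> bdd f -> Lp p f.
Proof.
move=> p0 mf [M hM]; apply/LpP => //; split => //.
have mfp : measurable_fun I01 (fun t => `|f t| `^ p).
  apply: (@measurableT_comp _ _ _ _ _ _ (@powR R ^~ p)) => //.
  exact: measurableT_comp.
have : mu.-integrable I01 (EFin \o (fun t => `|f t| `^ p)).
  apply: integrable_bdd => //; exists (M `^ p) => t It.
  rewrite ger0_norm ?powR_ge0// ge0_ler_powR ?nnegrE ?(ltW p0) ?hM//.
  by rewrite (le_trans _ (hM _ It)).
move=> /integrableP[_]; apply: le_lt_trans.
by under [leRHS]eq_integral do rewrite gee0_abs ?lee_fin ?powR_ge0//.
Qed.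

End LpI01.

(** * Pointwise estimates of the Sadowsky integrand *)

Section Vectors.
Context {R : realType}.
Implicit Types (a b c v w : 'rV[R]_3).

Definition trip a b c : R := dot a (cross b c).

Lemma dotE v w : dot v w = v 0 0 * w 0 0 + v 0 1 * w 0 1 + v 0 (1 + 1) * w 0 (1 + 1).
Proof.
rewrite /dot !big_ord_recl big_ord0 addr0 addrA.
have -> : lift ord0 ord0 = 1 :> 'I_3 by apply/val_inj.
by have -> : lift ord0 (lift ord0 ord0) = 1 + 1 :> 'I_3 by apply/val_inj.
Qed.

Lemma cross0E v w : cross v w 0 0 = v 0 1 * w 0 (1 + 1) - v 0 (1 + 1) * w 0 1.
Proof. by rewrite mxE add0r. Qed.

Lemma cross1E v w : cross v w 0 1 = v 0 (1 + 1) * w 0 0 - v 0 0 * w 0 (1 + 1).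
Proof. by rewrite mxE (_ : 1 + 1 + 1 = 0 :> 'I_3)//; apply/val_inj. Qed.

Lemma cross2E v w : cross v w 0 (1 + 1) = v 0 0 * w 0 1 - v 0 1 * w 0 0.
Proof. by rewrite mxE (_ : 1 + 1 + 1 = 0 :> 'I_3) ?add0r//; apply/val_inj. Qed.

Definition crossE := (cross0E, cross1E, cross2E).

Lemma dot_ge0 v : 0 <= dot v v.
Proof. by rewrite dotE !addr_ge0// -expr2 sqr_ge0. Qed.

Lemma enorm_ge0 v : 0 <= enorm v.
Proof. exact: sqrtr_ge0. Qed.

Lemma sqr_enorm v : enorm v ^+ 2 = dot v v.
Proof. by rewrite sqr_sqrtr// dot_ge0. Qed.

(** Lagrange's identity; dropping either square on the right gives the Cauchy-Schwarz inequality or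
    the bound on the cross product. *)
Lemma lagrange v w :
  dot v v * dot w w = dot v w ^+ 2 + dot (cross v w) (cross v w).
Proof. by rewrite !dotE !crossE; ring. Qed.

Lemma dot_le v w : `|dot v w| <= enorm v * enorm w.
Proof.
rewrite -(@ler_pXn2r _ 2)// ?nnegrE ?mulr_ge0 ?enorm_ge0//.
by rewrite real_normK ?num_real// exprMn !sqr_enorm lagrange lerDl dot_ge0.
Qed.

Lemma cross_le v w : enorm (cross v w) <= enorm v * enorm w.
Proof.
rewrite -(@ler_pXn2r _ 2)// ?nnegrE ?mulr_ge0 ?enorm_ge0//.
by rewrite exprMn !sqr_enorm lagrange lerDr sqr_ge0.
Qed.

Lemma trip_le a b c : `|trip a b c| <= enorm a * enorm b * enorm c.
Proof.
by rewrite (le_trans (dot_le _ _))// -mulrA ler_wpM2l ?enorm_ge0 ?cross_le.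
Qed.

Lemma enormN v : enorm (- v) = enorm v.
Proof. by rewrite /enorm !dotE !mxE !mulrNN. Qed.

Lemma enormBC v w : enorm (v - w) = enorm (w - v).
Proof. by rewrite -enormN opprB. Qed.

Lemma enormD v w : enorm (v + w) <= enorm v + enorm w.
Proof.
rewrite -(@ler_pXn2r _ 2)// ?nnegrE ?addr_ge0 ?enorm_ge0//.
have := le_trans (ler_norm _) (dot_le v w).
rewrite sqr_enorm sqrrD !sqr_enorm => h.
have -> : dot (v + w) (v + w) = dot v v + dot v w *+ 2 + dot w w.
  by rewrite !dotE !mxE; ring.
by rewrite lerD2r lerD2l lerMn2r h orbT.
Qed.

Lemma enorm_dist v w : `|enorm v - enorm w| <= enorm (v - w).
Proof.
rewrite ler_norml; apply/andP; split.
  by rewrite lerNl opprB lerBlDr enormBC -[X in enorm X <= _](subrK v) enormD.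
by rewrite lerBlDr -[X in enorm X <= _](subrK w) enormD.
Qed.

Lemma enormZ (x : R) v : enorm (x *: v) = `|x| * enorm v.
Proof.
have -> : enorm (x *: v) = Num.sqrt (x ^+ 2 * dot v v).
  by rewrite /enorm !dotE !mxE; congr Num.sqrt; ring.
by rewrite sqrtrM ?sqr_ge0// sqrtr_sqr.
Qed.

(** Among the possible telescopings, this one multiplies the differences of a and b by the old [c]
    and never by [c']. Hence only the tail of the reference curve appears later. *)
Lemma trip_diff a b c a' b' c' : trip a' b' c' - trip a b c =
  trip a' b' (c' - c) + trip (a' - a) b' c + trip a (b' - b) c.
Proof. by rewrite /trip !dotE !crossE !mxE; ring. Qed.

Lemma tripZ (x : R) a b c : trip a (x *: b) c = x * trip a b c.
Proof. by rewrite /trip !dotE !crossE !mxE; ring. Qed.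

Definition sadowsky_density a b c : R :=
  enorm b ^+ 2 * (1 + (trip a b c / enorm b ^+ 3) ^+ 2) ^+ 2.

Lemma sadowsky_density_ge0 a b c : 0 <= sadowsky_density a b c.
Proof. by rewrite mulr_ge0// sqr_ge0. Qed.

(** With a = u', b = u'', c = u''' this is sqrt kappa times eta, namely the triple product divided
    by |b|^(5/2). One factor 1/|b| is absorbed into the unit vector b/|b|, so that differences are
    controlled by a lower bound on |b| only. *)
Definition twist a b c : R :=
  (Num.sqrt (enorm b))^-1 ^+ 3 * trip a ((enorm b)^-1 *: b) c.

(* The fourth root of the integrand is the length of the planar vector
   (sqrt |b|, twist a b c). *)
Lemma sadowsky_densityE a b c : 0 < enorm b ->
  sadowsky_density a b c = (Num.sqrt (enorm b) ^+ 2 + twist a b c ^+ 2) ^+ 2.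
Proof.
move=> b0; rewrite /sadowsky_density /twist tripZ.
set q := Num.sqrt _; have q0 : q != 0 by rewrite gt_eqF// sqrtr_gt0.
have -> : enorm b = q ^+ 2 by rewrite sqr_sqrtr// ltW.
by field.
Qed.

Lemma sqrD_young (t x y : R) : 0 < t ->
  (x + y) ^+ 2 <= (1 + t) * x ^+ 2 + (1 + t^-1) * y ^+ 2.
Proof.
move=> t0; rewrite -subr_ge0.
have -> : (1 + t) * x ^+ 2 + (1 + t^-1) * y ^+ 2 - (x + y) ^+ 2 = t^-1 * (t * x - y) ^+ 2.
  by field; rewrite gt_eqF.
by rewrite mulr_ge0 ?sqr_ge0// invr_ge0 ltW.
Qed.

(** Young's inequality is used once on each coordinate and once on the outer square, whence the
    exponent 3. The leading factor tends to 1 with t, as Minkowski's inequality would allow. *)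
Lemma sqr_sum_young (t x y x' y' : R) : 0 < t ->
  (x' ^+ 2 + y' ^+ 2) ^+ 2 <= (1 + t) ^+ 3 * (x ^+ 2 + y ^+ 2) ^+ 2 +
    (1 + t^-1) ^+ 3 * ((x' - x) ^+ 2 + (y' - y) ^+ 2) ^+ 2.
Proof.
move=> t0; have ti0 : 0 < t^-1 by rewrite invr_gt0.
have hx := sqrD_young x (x' - x) t0; rewrite subrKC in hx.
have hy := sqrD_young y (y' - y) t0; rewrite subrKC in hy.
set P := x ^+ 2 + y ^+ 2; set Q := (x' - x) ^+ 2 + (y' - y) ^+ 2.
have h : x' ^+ 2 + y' ^+ 2 <= (1 + t) * P + (1 + t^-1) * Q.
  by apply: (le_trans (lerD hx hy)); rewrite le_eqVlt; apply/orP; left; apply/eqP; rewrite /P /Q; ring.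
have h2 : (x' ^+ 2 + y' ^+ 2) ^+ 2 <= ((1 + t) * P + (1 + t^-1) * Q) ^+ 2.
  have Z0 : 0 <= x' ^+ 2 + y' ^+ 2 by rewrite addr_ge0 ?sqr_ge0.
  by rewrite ler_pXn2r// nnegrE// (le_trans Z0).
apply: (le_trans h2); apply: (le_trans (sqrD_young _ _ t0)).
by rewrite le_eqVlt; apply/orP; left; apply/eqP; ring.
Qed.

Lemma pow4D (x y : R) : (x + y) ^+ 4 <= 8 * (x ^+ 4 + y ^+ 4).
Proof.
have h : (x + y) ^+ 2 <= 2 * (x ^+ 2 + y ^+ 2).
  rewrite -subr_ge0 (_ : _ - _ = (x - y) ^+ 2) ?sqr_ge0//; ring.
have h2 : (x ^+ 2 + y ^+ 2) ^+ 2 <= 2 * (x ^+ 4 + y ^+ 4).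
  rewrite -subr_ge0 (_ : _ - _ = (x ^+ 2 - y ^+ 2) ^+ 2) ?sqr_ge0//; ring.
have h3 : (x + y) ^+ 4 <= (2 * (x ^+ 2 + y ^+ 2)) ^+ 2.
  rewrite (_ : (x + y) ^+ 4 = ((x + y) ^+ 2) ^+ 2); last by rewrite -exprM.
  by rewrite ler_pXn2r// nnegrE ?sqr_ge0// mulr_ge0// addr_ge0 ?sqr_ge0.
apply: (le_trans h3); rewrite exprMn.
have -> : 8 * (x ^+ 4 + y ^+ 4) = 2 ^+ 2 * (2 * (x ^+ 4 + y ^+ 4)) by ring.
by rewrite ler_wpM2l// sqr_ge0.
Qed.

Lemma sqr2D (x y : R) : (x + y) ^+ 2 <= 2 * (x ^+ 2 + y ^+ 2).
Proof. rewrite -subr_ge0 (_ : _ - _ = (x - y) ^+ 2) ?sqr_ge0//; ring. Qed.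

Lemma sqrt_lip (k x y : R) : 0 < k -> k <= x -> k <= y ->
  `|Num.sqrt x - Num.sqrt y| <= (Num.sqrt k)^-1 * `|x - y|.
Proof.
move=> k0 kx ky.
have q0 : 0 < Num.sqrt k by rewrite sqrtr_gt0.
have x0 : 0 <= x by rewrite (le_trans (ltW k0)).
have y0 : 0 <= y by rewrite (le_trans (ltW k0)).
rewrite ler_pdivlMl//.
have -> : x - y = (Num.sqrt x - Num.sqrt y) * (Num.sqrt x + Num.sqrt y).
  by rewrite -subr_sqr !sqr_sqrtr.
rewrite normrM mulrC ler_wpM2l// ger0_norm ?addr_ge0 ?sqrtr_ge0//.
by rewrite (le_trans (ler_wsqrtr kx))// lerDl sqrtr_ge0.
Qed.

Lemma inv_lip (k x y : R) : 0 < k -> k <= x -> k <= y ->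
  `|x^-1 - y^-1| <= k^-1 ^+ 2 * `|x - y|.
Proof.
move=> k0 kx ky.
have x0 : 0 < x by rewrite (lt_le_trans k0).
have y0 : 0 < y by rewrite (lt_le_trans k0).
have -> : x^-1 - y^-1 = (x^-1 * y^-1) * (y - x).
  by field; rewrite !gt_eqF.
rewrite normrM distrC ler_wpM2r// ger0_norm ?mulr_ge0 ?invr_ge0 ?(ltW x0) ?(ltW y0)//.
by rewrite expr2 ler_pM ?invr_ge0 ?(ltW x0) ?(ltW y0)// lef_pV2 ?posrE.
Qed.

Lemma cube_lip (K x y : R) : 0 <= x <= K -> 0 <= y <= K ->
  `|x ^+ 3 - y ^+ 3| <= 3 * K ^+ 2 * `|x - y|.
Proof.
move=> /andP[x0 xK] /andP[y0 yK].
have K0 : 0 <= K by apply: le_trans xK.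
have -> : x ^+ 3 - y ^+ 3 = (x ^+ 2 + x * y + y ^+ 2) * (x - y) by ring.
rewrite normrM ler_wpM2r// ger0_norm; last by rewrite !addr_ge0 ?mulr_ge0 ?sqr_ge0.
have h1 : x ^+ 2 <= K ^+ 2 by rewrite ler_pXn2r ?nnegrE.
have h2 : y ^+ 2 <= K ^+ 2 by rewrite ler_pXn2r ?nnegrE.
have h3 : x * y <= K ^+ 2 by rewrite expr2 ler_pM.
by rewrite (_ : 3 * K ^+ 2 = K ^+ 2 + K ^+ 2 + K ^+ 2) ?lerD//; ring.
Qed.

Lemma normalize_lip (k : R) b b' : 0 < k -> k <= enorm b -> k <= enorm b' ->
  enorm ((enorm b')^-1 *: b' - (enorm b)^-1 *: b) <= 2 * k^-1 * enorm (b' - b).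
Proof.
move=> k0 kb kb'.
have b0 : 0 < enorm b by rewrite (lt_le_trans k0).
have b'0 : 0 < enorm b' by rewrite (lt_le_trans k0).
have -> : (enorm b')^-1 *: b' - (enorm b)^-1 *: b =
    (enorm b')^-1 *: (b' - b) + ((enorm b')^-1 - (enorm b)^-1) *: b.
  by rewrite scalerBr scalerBl addrA subrK.
rewrite (le_trans (enormD _ _))// !enormZ.
have -> : (enorm b')^-1 - (enorm b)^-1 = (enorm b')^-1 * (enorm b)^-1 * (enorm b - enorm b').
  by field; rewrite !gt_eqF.
rewrite !normrM !normfV !(ger0_norm (enorm_ge0 _)).
rewrite [X in _ + X](_ : _ = (enorm b')^-1 * `|enorm b - enorm b'|); last first.
  by field; rewrite !gt_eqF.
rewrite -mulrDr [2 * _]mulrC -mulrA ler_pM ?invr_ge0 ?(ltW b'0) ?addr_ge0 ?enorm_ge0//.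
  by rewrite lef_pV2 ?posrE.
by rewrite mulr2n mulrDl mul1r lerD// distrC enorm_dist.
Qed.

Lemma enorm_normalize b : 0 < enorm b -> enorm ((enorm b)^-1 *: b) = 1.
Proof.
by move=> b0; rewrite enormZ ger0_norm ?invr_ge0 ?enorm_ge0// mulVf// gt_eqF.
Qed.

(** The coefficient [th] of |c| has two bounds, one small with the differences of a and b, one
    absolute. The first serves where |c| is moderate, the second where |c| is large. *)
Lemma twist_diff (k : R) : 0 < k -> exists2 C, 0 < C &
  forall a b c a' b' c', enorm a = 1 -> enorm a' = 1 -> k <= enorm b -> k <= enorm b' ->
  exists2 th, 0 <= th <= C & th <= C * (enorm (a' - a) + enorm (b' - b)) /\
   `|twist a' b' c' - twist a b c| <= C * enorm (c' - c) + enorm c * th.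
Proof.
move=> k0.
pose q := Num.sqrt k; have q0 : 0 < q by rewrite sqrtr_gt0.
pose K := q^-1 ^+ 3; have K0 : 0 < K by rewrite exprn_gt0// invr_gt0.
pose L := 3 * q^-1 ^+ 2 * (q^-1 ^+ 2 * q^-1).
have qi0 : 0 <= q^-1 by rewrite invr_ge0 ltW.
have Kge : 0 <= K by exact: ltW.
have kV0 : 0 <= k^-1 by rewrite invr_ge0 ltW.
have ki0 : 0 <= 2 * k^-1 by rewrite mulr_ge0// invr_ge0 ltW.
have L0 : 0 <= L by rewrite !mulr_ge0 ?exprn_ge0.
(* 5 K is the absolute bound 2 K + 2 K + K on the three terms of [th]; the remaining summands are
   the Lipschitz constants in b of the direction and of the cubed factor. *)
exists (5 * K + (K * (2 * k^-1) + L)).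
  apply: ltr_pwDl; first by apply: mulr_gt0.
  by apply: addr_ge0 => //; apply: mulr_ge0.
move=> a b c a' b' c' a1 a'1 kb kb'.
have b0 : 0 < enorm b by rewrite (lt_le_trans k0).
have b'0 : 0 < enorm b' by rewrite (lt_le_trans k0).
set n := (enorm b)^-1 *: b; set n' := (enorm b')^-1 *: b'.
set r := (Num.sqrt (enorm b))^-1; set r' := (Num.sqrt (enorm b'))^-1.
have rr x : k <= x -> 0 <= (Num.sqrt x)^-1 <= q^-1.
  move=> kx; rewrite invr_ge0 sqrtr_ge0/= lef_pV2 ?posrE ?sqrtr_gt0//.
    exact: ler_wsqrtr.
  by rewrite (lt_le_trans k0).
have r3 x : 0 <= x <= q^-1 -> 0 <= x ^+ 3 <= K.
  move=> /andP[h1 h2]; rewrite exprn_ge0//= /K.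
  by rewrite ler_pXn2r// nnegrE// (le_trans h1).
have n1 : enorm n = 1 by apply: enorm_normalize.
have n'1 : enorm n' = 1 by apply: enorm_normalize.
have /andP[r3p r3K] := r3 _ (rr _ kb).
have /andP[r3p' r3K'] := r3 _ (rr _ kb').
have dr : `|r' ^+ 3 - r ^+ 3| <= L * enorm (b' - b).
  apply: (le_trans (cube_lip (rr _ kb') (rr _ kb))).
  rewrite /L -[leRHS]mulrA ler_wpM2l ?mulr_ge0 ?exprn_ge0 ?invr_ge0 ?(ltW q0)//.
  apply: (le_trans (inv_lip q0 (ler_wsqrtr kb') (ler_wsqrtr kb))).
  rewrite -[leRHS]mulrA ler_wpM2l ?exprn_ge0 ?invr_ge0 ?(ltW q0)//.
  apply: (le_trans (sqrt_lip k0 kb' kb)).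
  by rewrite ler_wpM2l ?invr_ge0 ?(ltW q0)// enorm_dist.
have dr2 : `|r' ^+ 3 - r ^+ 3| <= K.
  rewrite -/r in r3p r3K; rewrite -/r' in r3p' r3K'.
  by rewrite ler_norml; apply/andP; split; lra.
have dn : enorm (n' - n) <= 2 * k^-1 * enorm (b' - b) by apply: normalize_lip.
have dn2 : enorm (n' - n) <= 2 by rewrite (le_trans (enormD _ _))// enormN n1 n'1.
have da2 : enorm (a' - a) <= 2 by rewrite (le_trans (enormD _ _))// enormN a1 a'1.
have [x0 y0] := (enorm_ge0 (a' - a), enorm_ge0 (b' - b)).
have [z0 c0] := (enorm_ge0 (c' - c), enorm_ge0 c).
(* Everything that multiplies |c|: the changes of the tangent, of the direction of b and of the
   scalar factor. *)
exists (K * enorm (a' - a) + K * enorm (n' - n) + `|r' ^+ 3 - r ^+ 3|); last split.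
- rewrite !addr_ge0 ?mulr_ge0 ?(ltW K0) ?enorm_ge0//=.
  apply: (@le_trans _ _ (K * 2 + K * 2 + K)).
    by rewrite !lerD// ler_wpM2l.
  rewrite (_ : K * 2 + K * 2 + K = 5 * K); last by ring.
  by rewrite lerDl addr_ge0// mulr_ge0.
- apply: (@le_trans _ _ (K * enorm (a' - a) + K * (2 * k^-1 * enorm (b' - b)) + L * enorm (b' - b))).
    by rewrite !lerD// ler_wpM2l.
  have : 0 <= K * enorm (a' - a) by rewrite mulr_ge0.
  have : 0 <= K * enorm (b' - b) by rewrite mulr_ge0.
  have : 0 <= K * (2 * k^-1) * enorm (a' - a) by rewrite !mulr_ge0.
  have : 0 <= L * enorm (a' - a) by rewrite !mulr_ge0.
  lra.
- have -> : twist a' b' c' - twist a b c =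
    r' ^+ 3 * (trip a' n' c' - trip a n c) + (r' ^+ 3 - r ^+ 3) * trip a n c.
    by rewrite /twist -/n -/n' -/r -/r'; ring.
  rewrite (le_trans (ler_normD _ _))// (normrM (r' ^+ 3)) (normrM (r' ^+ 3 - r ^+ 3)).
  rewrite (ger0_norm (r3p' : 0 <= r' ^+ 3)).
  have t1 : `|trip a n c| <= enorm c.
    by rewrite (le_trans (trip_le _ _ _))// a1 n1 !mul1r.
  have t2 : `|trip a' n' c' - trip a n c| <=
      enorm (c' - c) + enorm (a' - a) * enorm c + enorm (n' - n) * enorm c.
    rewrite trip_diff (le_trans (ler_normD _ _))// lerD//; last first.
      by rewrite (le_trans (trip_le _ _ _))// a1 mul1r.
    rewrite (le_trans (ler_normD _ _))// lerD// (le_trans (trip_le _ _ _))//.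
      by rewrite a'1 n'1 !mul1r.
    by rewrite n'1 mulr1.
  apply: (@le_trans _ _ (K * (enorm (c' - c) + enorm (a' - a) * enorm c + enorm (n' - n) * enorm c) +
      `|r' ^+ 3 - r ^+ 3| * enorm c)).
    by apply: lerD; [exact: ler_pM|exact: ler_wpM2l].
  have : 0 <= K * (2 * k^-1) * enorm (c' - c) by rewrite !mulr_ge0.
  have : 0 <= L * enorm (c' - c) by rewrite !mulr_ge0.
  have : 0 <= K * enorm (c' - c) by rewrite !mulr_ge0.
  lra.
Qed.

(* c is only L^4, so the differences of a and b, which it multiplies, are not
   small in the product; truncating |c| at T leaves a small tail instead. *)
Lemma planar_diff (k : R) : 0 < k -> exists2 C, 0 < C &
  forall (T : R) a b c a' b' c', 0 <= T ->
  enorm a = 1 -> enorm a' = 1 -> k <= enorm b -> k <= enorm b' ->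
  ((Num.sqrt (enorm b') - Num.sqrt (enorm b)) ^+ 2 + (twist a' b' c' - twist a b c) ^+ 2) ^+ 2
  <= C * ((1 + T ^+ 4) * (enorm (a' - a) ^+ 4 + enorm (b' - b) ^+ 4) + enorm (c' - c) ^+ 4
     + (if enorm c <= T then 0 else enorm c ^+ 4)).
Proof.
move=> k0; have [D D0 hD] := twist_diff k0.
pose q := Num.sqrt k; have q0 : 0 < q by rewrite sqrtr_gt0.
(* 128 = 2 * 8 * 8: [sqr2D] for the outer square, then [pow4D] once to split off |c' - c| and once
   to separate a from b. *)
exists (2 * q^-1 ^+ 4 + 128 * D ^+ 4).
  by rewrite addr_gt0// mulr_gt0// exprn_gt0// invr_gt0.
move=> T a b c a' b' c' T0 a1 a'1 kb kb'.
have [th /andP[th0 thD] [th1 tw]] := hD _ _ c _ _ c' a1 a'1 kb kb'.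
set x := enorm (a' - a) in th1 *; set y := enorm (b' - b) in th1 *.
set z := enorm (c' - c) in tw *.
have x0 : 0 <= x by exact: enorm_ge0.
have y0 : 0 <= y by exact: enorm_ge0.
have z0 : 0 <= z by exact: enorm_ge0.
have c0 : 0 <= enorm c by exact: enorm_ge0.
have mono4 (u v : R) : 0 <= u -> u <= v -> u ^+ 4 <= v ^+ 4.
  by move=> u0 uv; rewrite ler_pXn2r// nnegrE// (le_trans u0).
have even4 (u : R) : `|u| ^+ 4 = u ^+ 4 :> R.
  by rewrite -normrX ger0_norm// (_ : 4%N = (2 * 2)%N)// exprM sqr_ge0.
set dq := Num.sqrt (enorm b') - _; set dt := twist a' b' c' - _.
have hq : dq ^+ 4 <= q^-1 ^+ 4 * y ^+ 4.
  rewrite -(even4 dq) -exprMn mono4// /dq (le_trans (sqrt_lip k0 kb' kb))//.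
  by rewrite ler_wpM2l ?invr_ge0 ?(ltW q0)// enorm_dist.
have ht : dt ^+ 4 <= 8 * (D ^+ 4 * z ^+ 4 + enorm c ^+ 4 * th ^+ 4).
  by rewrite -(even4 dt) (le_trans (mono4 _ _ _ tw))// (le_trans (pow4D _ _))// !exprMn.
have hc : enorm c ^+ 4 * th ^+ 4 <= 8 * D ^+ 4 * (T ^+ 4 * (x ^+ 4 + y ^+ 4) +
    (if enorm c <= T then 0 else enorm c ^+ 4)).
  (* Below the truncation level the Lipschitz bound on [th] applies with |c| at most T; above it,
     the absolute bound. *)
  case: ifPn => cT.
    apply: (@le_trans _ _ (T ^+ 4 * (D ^+ 4 * (8 * (x ^+ 4 + y ^+ 4))))).
      rewrite ler_pM ?exprn_ge0// ?mono4//.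
      apply: (le_trans (mono4 _ _ th0 th1)); rewrite exprMn.
      by rewrite ler_wpM2l ?exprn_ge0 ?(ltW D0)// pow4D.
    by rewrite le_eqVlt; apply/orP; left; apply/eqP; ring.
  apply: (@le_trans _ _ (enorm c ^+ 4 * D ^+ 4)).
    by rewrite ler_wpM2l ?exprn_ge0// mono4.
  have : 0 <= D ^+ 4 * (T ^+ 4 * (x ^+ 4 + y ^+ 4)).
    by rewrite !mulr_ge0 ?addr_ge0 ?exprn_ge0// (ltW D0).
  have : 0 <= enorm c ^+ 4 * D ^+ 4 by rewrite !mulr_ge0 ?exprn_ge0// (ltW D0).
  lra.
apply: (le_trans (sqr2D _ _)); rewrite -!exprM.
move: hc; set e := (if _ then _ else _) => hc.
have e0 : 0 <= e by rewrite /e; case: ifP => // _; rewrite exprn_ge0.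
have [X0 Y0 Z0 T40] : [/\ 0 <= x ^+ 4, 0 <= y ^+ 4, 0 <= z ^+ 4 & 0 <= T ^+ 4].
  by split; rewrite exprn_ge0.
have D4 : 0 <= D ^+ 4 by rewrite exprn_ge0 ?(ltW D0).
have Q4 : 0 <= q^-1 ^+ 4 by rewrite exprn_ge0// invr_ge0 ltW.
have p1 : 0 <= q^-1 ^+ 4 * x ^+ 4 by rewrite mulr_ge0.
have p2 : 0 <= q^-1 ^+ 4 * z ^+ 4 by rewrite mulr_ge0.
have p3 : 0 <= q^-1 ^+ 4 * e by rewrite mulr_ge0.
have p4 : 0 <= q^-1 ^+ 4 * (T ^+ 4 * (x ^+ 4 + y ^+ 4)).
  by apply: mulr_ge0 => //; apply: mulr_ge0 => //; apply: addr_ge0.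
have p5 : 0 <= D ^+ 4 * x ^+ 4 by rewrite mulr_ge0.
have p6 : 0 <= D ^+ 4 * y ^+ 4 by rewrite mulr_ge0.
have p7 : 0 <= D ^+ 4 * z ^+ 4 by rewrite mulr_ge0.
have p8 : 0 <= D ^+ 4 * e by rewrite mulr_ge0.
have p9 : 0 <= D ^+ 4 * (T ^+ 4 * (x ^+ 4 + y ^+ 4)).
  by apply: mulr_ge0 => //; apply: mulr_ge0 => //; apply: addr_ge0.
lra.
Qed.

End Vectors.

(** * Sobolev curves *)

Section SmoothCurves.
Context {R : realType}.
Notation mu := (@lebesgue_measure R).
Implicit Types (u v y : R -> 'rV[R]_3).

(** The limits bound f near the two ends, and compactness bounds it on the segment between. *)
Lemma bdd_limits (f : R -> R) : (forall t, I01 t -> {for t, continuous f}) ->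
  cvg (f t @[t --> 0^'+]) -> cvg (f t @[t --> 1^'-]) -> bdd f.
Proof.
move=> cf /cvg_ex[l0 /cvgrPdist_lt/(_ 1 ltr01) h0] /cvg_ex[l1 /cvgrPdist_lt/(_ 1 ltr01) h1].
have [d0 /= d0p H0] : nbhs_ball (0 : R) [set t | 0 < t -> `|l0 - f t| < 1] by exact/nbhs_ballP.
have [d1 /= d1p H1] : nbhs_ball (1 : R) [set t | t < 1 -> `|l1 - f t| < 1] by exact/nbhs_ballP.
have [M hM] : exists M, forall t, d0 <= t <= 1 - d1 -> `|f t| <= M.
  have : compact (f @` `[d0, 1 - d1]).
    apply: continuous_compact; last exact: segment_compact.
    apply: continuous_in_subspaceT => t; rewrite inE/= in_itv/= => /andP[t0 t1].
    by apply: cf; apply/I01E; rewrite (lt_le_trans d0p)// (le_lt_trans t1)// ltrBlDr ltrDl.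
  move=> /compact_bounded [M [_ hM]]; exists (`|M| + 1) => t ht.
  by apply: (hM (`|M| + 1)); [rewrite ltr_pwDr// ler_norm|exists t => //=; rewrite in_itv].
exists (`|M| + (`|l0| + 1) + (`|l1| + 1)) => t /I01E/andP[t0 t1].
have near_le (l x : R) : `|l - x| < 1 -> `|x| <= `|l| + 1.
  move=> h; rewrite -lerBlDl (le_trans _ (ltW h))// distrC.
  exact: lerB_dist.
have M0 := ler_norm M.
have n0 := normr_ge0 l0; have n1 := normr_ge0 l1; have nM := normr_ge0 M.
have [td0|td0] := ltP t d0.
  have : `|l0 - f t| < 1 by apply: H0 => //; rewrite -ball_normE /= sub0r normrN gtr0_norm.
  move=> /near_le; lra.
have [td1|td1] := ltP (1 - d1) t.
  have : `|l1 - f t| < 1.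
    by apply: H1 => //; rewrite -ball_normE /= gtr0_norm ?subr_gt0// ltrBlDr addrC -ltrBlDr.
  move=> /near_le; lra.
have := hM t; rewrite td0 td1 => /(_ isT); lra.
Qed.

Lemma derive1n_coord u k i : (forall k t, I01 t -> derivable (derive1n k u) t 1) ->
  forall t, I01 t -> derive1n k u t 0 i = derive1n k (fun s => u s 0 i) t.
Proof.
move=> du; elim: k => // k IH t It.
rewrite !derive1nS !derive1E derive_mx; last exact: du.
rewrite mxE; apply: near_eq_derive.
by apply: filterS (near_I01 It) => s; exact: IH.
Qed.

Lemma derivable_coord u k i : (forall k t, I01 t -> derivable (derive1n k u) t 1) ->
  forall t, I01 t -> derivable (derive1n k (fun s => u s 0 i)) t 1.
Proof.
move=> du t It; have /derivable_mxP/(_ 0 i) := du k _ It.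
apply: near_eq_derivable.
by apply: filterS (near_I01 It) => s Is; rewrite derive1n_coord.
Qed.

Lemma cvg_coord u (F : set_system R) i :
  cvg (u t @[t --> F]) -> cvg (u t 0 i @[t --> F]).
Proof.
move=> /cvg_ex[l ul]; apply/cvg_ex; exists (l 0 i).
exact: (cvg_comp _ _ ul (@coord_continuous R 1 3 0 i l)).
Qed.

Lemma smooth01_c1b u k i : smooth01 u ->
  c1b (derive1n k (fun s => u s 0 i)) (derive1n k.+1 (fun s => u s 0 i)).
Proof.
move=> [_ du c0 c1].
have dk j t : I01 t ->
    is_derive t 1 (derive1n j (fun s => u s 0 i)) (derive1n j.+1 (fun s => u s 0 i) t).
  by move=> It; rewrite derive1nS derive1E; apply: derivableP; exact: derivable_coord.
have ck j t : I01 t -> {for t, continuous (derive1n j (fun s => u s 0 i))}.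
  by move=> It; exact: is_derive_continuous (dk j t It).
have bk j : bdd (derive1n j (fun s => u s 0 i)).
  apply: bdd_limits; first exact: ck.
  - have ci := cvg_coord (i := i) (c0 j).
    have [l hl] := (cvg_ex _).1 ci; apply/cvg_ex; exists l.
    apply: cvg_trans hl; apply: near_eq_cvg; near=> t.
    rewrite derive1n_coord//; apply/I01E/andP; split.
      by near: t; exact: nbhs_right_gt.
    by near: t; exact: nbhs_right_lt.
  - have ci := cvg_coord (i := i) (c1 j).
    have [l hl] := (cvg_ex _).1 ci; apply/cvg_ex; exists l.
    apply: cvg_trans hl; apply: near_eq_cvg; near=> t.
    rewrite derive1n_coord//; apply/I01E/andP; split.
      by near: t; exact: nbhs_left_gt.
    by near: t; exact: nbhs_left_lt.
by split=> //; [exact: dk|exact: ck].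
Unshelve. all: by end_near. Qed.

Lemma smooth01_weak u k i : smooth01 u ->
  weak_derivative k (fun s => u s 0 i) (derive1n k (fun s => u s 0 i)).
Proof.
move=> su; apply: (@weak_derivative_c1b _ (fun k => derive1n k (fun s => u s 0 i))).
by move=> j; exact: smooth01_c1b.
Qed.

Lemma c1b_measurable (f g : R -> R) : c1b f g -> measurable_fun I01 f.
Proof. by move=> h; apply: measurable_continuous_I01; exact: c1b_continuous h. Qed.

Lemma smooth01_Wkp3 u k p : 0 < p -> smooth01 u -> Wkp3 k p u.
Proof.
move=> p0 su i j _; exists (derive1n j (fun s => u s 0 i)); first exact: smooth01_weak.
have h := smooth01_c1b j i su; have [_ _ b _] := h.
by apply: Lp_bdd => //; exact: c1b_measurable h.
Qed.

Lemma weakD3_ae j u v :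
  (forall i, weak_derivative j (fun t => u t 0 i) (fun t => v t 0 i)) ->
  {ae mu, forall t, I01 t -> weakD3 j u t = v t}.
Proof.
move=> h.
have : {ae mu, forall t, forall i : 'I_3, I01 t -> weakD3 j u t 0 i = v t 0 i}.
  apply: (@filter_forall _ _ _ _ (ae_filter_ringOfSetsType mu)) => i.
  by apply: ae_impl (weakD_ae (h i)) => t; rewrite mxE.
by apply: ae_impl => t ht It; apply/rowP => i; exact: ht.
Qed.

Lemma smooth01_weakD3 u j : smooth01 u ->
  {ae mu, forall t, I01 t -> weakD3 j u t = derive1n j u t}.
Proof.
move=> su; have [_ du _ _] := su.
have : {ae mu, forall t, I01 t -> weakD3 j u t = \row_i derive1n j (fun s => u s 0 i) t}.
  apply: weakD3_ae => i.
  by under [X in weak_derivative _ _ X]eq_fun do rewrite mxE; exact: smooth01_weak.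
apply: ae_impl => t ht It; rewrite ht//; apply/rowP => i; rewrite mxE.
by rewrite derive1n_coord.
Qed.

Lemma Wkp3_weak k p u j i : Wkp3 k p u -> (j <= k)%N ->
  weak_derivative j (fun t => u t 0 i) (fun t => weakD3 j u t 0 i).
Proof.
move=> /(_ i j) h /h[g hg _].
by under [X in weak_derivative _ _ X]eq_fun do rewrite mxE; exact: weakDP hg.
Qed.

Lemma measurable_weakD3 k p u j i : Wkp3 k p u -> (j <= k)%N ->
  measurable_fun I01 (fun t => weakD3 j u t 0 i).
Proof. by move=> hu jk; have [_ [+ _ _] _] := Wkp3_weak i hu jk. Qed.

Lemma weakD3B k p u v j : Wkp3 k p u -> Wkp3 k p v -> (j <= k)%N ->
  {ae mu, forall t, I01 t -> weakD3 j (u \- v)%R t = weakD3 j u t - weakD3 j v t}.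
Proof.
move=> hu hv jk; apply: weakD3_ae => i.
have := weak_derivativeB (Wkp3_weak i hu jk) (Wkp3_weak i hv jk).
congr weak_derivative; apply/funext => t; first by rewrite /= !mxE.
by rewrite [RHS]mxE [X in _ = _ + X]mxE.
Qed.

(** Borel measurability does not pass through an almost everywhere equality such as [weakD3B]; it is
    read off the local integrability of the representative selected for the difference. *)
Lemma Wkp3B k p u v : Wkp3 k p u -> Wkp3 k p v -> forall j i, (j <= k)%N ->
  measurable_fun I01 (fun t => weakD3 j (u \- v)%R t 0 i).
Proof.
move=> hu hv j i jk.
have := weak_derivativeB (Wkp3_weak i hu jk) (Wkp3_weak i hv jk).
have -> : (fun t => u t 0 i) \- (fun t => v t 0 i) = fun t => (u \- v)%R t 0 i.
  by apply/funext => t; rewrite /= !mxE.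
move=> /weakDP [_ [m _ _] _].
by under eq_fun do rewrite mxE.
Qed.

Lemma measurable_dot (D : set R) (f g : R -> 'rV[R]_3) :
  (forall i, measurable_fun (D : set (measurableTypeR R)) (fun t => f t 0 i)) ->
  (forall i, measurable_fun (D : set (measurableTypeR R)) (fun t => g t 0 i)) ->
  measurable_fun (D : set (measurableTypeR R)) (fun t => dot (f t) (g t)).
Proof.
move=> mf mg; under eq_fun do rewrite dotE.
by repeat apply: measurable_funD; apply: measurable_funM.
Qed.

Lemma measurable_enorm (D : set R) (f : R -> 'rV[R]_3) :
  (forall i, measurable_fun (D : set (measurableTypeR R)) (fun t => f t 0 i)) ->
  measurable_fun (D : set (measurableTypeR R)) (fun t => enorm (f t)).
Proof.
move=> mf; rewrite /enorm.
apply: (@measurableT_comp _ _ _ _ _ _ (@Num.sqrt R)); last exact: measurable_dot.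
by apply: continuous_measurable_fun; exact: sqrt_continuous.
Qed.

Lemma measurable_cross (D : set R) (f g : R -> 'rV[R]_3) :
  (forall i, measurable_fun (D : set (measurableTypeR R)) (fun t => f t 0 i)) ->
  (forall i, measurable_fun (D : set (measurableTypeR R)) (fun t => g t 0 i)) ->
  forall i, measurable_fun (D : set (measurableTypeR R)) (fun t => cross (f t) (g t) 0 i).
Proof.
move=> mf mg i; under eq_fun do rewrite mxE.
by apply: measurable_funB; apply: measurable_funM.
Qed.

Lemma ae_eq_Lnorm p (f g : R -> R) : 0 < p ->
  measurable_fun I01 f -> measurable_fun I01 g ->
  {ae mu, forall t, I01 t -> `|f t| = `|g t|} ->
  ('N[mu]_(p%:E)[EFin \o (f \_ I01)] = 'N[mu]_(p%:E)[EFin \o (g \_ I01)])%E.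
Proof.
move=> p0 mf mg fg.
have pn0 : p != 0 by rewrite gt_eqF.
have E (h : R -> R) : ('N[mu]_(p%:E)[EFin \o (h \_ I01)] =
    (\int[mu]_(t in I01) (`|h t| `^ p)%:E) `^ p^-1)%E.
  by rewrite -(Lnorm_I01 _ pn0) -poweRrM mulfV// poweRe1// Lnorm_ge0.
have mp (h : R -> R) : measurable_fun I01 h -> measurable_fun I01 (fun t => `|h t| `^ p).
  move=> mh; apply: (@measurableT_comp _ _ _ _ _ _ (@powR R ^~ p)) => //.
  exact: measurableT_comp.
rewrite !E; congr (_ `^ _)%E; apply: ae_eq_integral_I01; [exact: mp..|].
by apply: ae_impl fg => t h It; rewrite (h It).
Qed.

(** [Xkmp] measures u - y while semicontinuity and convergence measure y - u, and the two selections
    of weak derivatives are independent. *)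
Lemma Wkp3_normC p u v : 0 < p -> Wkp3 3 p u -> Wkp3 3 p v ->
  Wkp3_norm 3 p (u \- v)%R = Wkp3_norm 3 p (v \- u)%R.
Proof.
move=> p0 hu hv; rewrite /Wkp3_norm; apply: eq_bigr => j _.
have j3 : (j <= 3)%N by rewrite -ltnS.
apply: ae_eq_Lnorm => //.
- by apply: measurable_enorm => i; exact: (Wkp3B hu hv).
- by apply: measurable_enorm => i; exact: (Wkp3B hv hu).
- apply: ae_impl2 (weakD3B hu hv j3) (weakD3B hv hu j3) => t h1 h2 It.
  by rewrite (h1 It) (h2 It) enormBC.
Qed.

Lemma Wkp3_norm0 p u : 0 < p -> Wkp3 3 p u -> Wkp3_norm 3 p (u \- u)%R = 0%E.
Proof.
move=> p0 hu; rewrite /Wkp3_norm big1// => j _.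
have j3 : (j <= 3)%N by rewrite -ltnS.
rewrite (@ae_eq_Lnorm p _ (cst 0))//.
- rewrite (_ : EFin \o _ = cst 0%E); first by rewrite Lnorm0// eqe gt_eqF.
  by apply/funext => t; rewrite /= patchE; case: ifP.
- by apply: measurable_enorm => i; exact: (Wkp3B hu hu).
- apply: ae_impl (weakD3B hu hu j3) => t h1 It.
  by rewrite (h1 It) subrr /enorm dotE !mxE mul0r !addr0 sqrtr0.
Qed.

(** A substitute for Hölder's inequality, by splitting at x = d. With d a bound on the L^p norm over
    an interval of length one, both terms integrate to at most d^4. *)
Lemma pow4_le_powR (p d x : R) : 4 <= p -> 0 < d -> 0 <= x ->
  x ^+ 4 <= d ^+ 4 + d `^ (4 - p) * x `^ p.
Proof.
move=> p4 d0 x0; have [xd|dx] := leP x d.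
  rewrite -[leLHS]addr0 lerD ?mulr_ge0 ?powR_ge0//.
  by rewrite ler_pXn2r// nnegrE ltW.
rewrite -[leLHS]add0r lerD ?exprn_ge0 ?(ltW d0)//.
have xp : 0 < x by exact: lt_trans dx.
have -> : x ^+ 4 = x `^ (4 - p) * x `^ p.
  rewrite -powRD; last by rewrite (gt_eqF xp) implybT.
  by rewrite subrK -powR_mulrn.
rewrite ler_wpM2r ?powR_ge0//.
rewrite -(opprB p 4) !powRN lef_pV2 ?posrE ?powR_gt0//.
by rewrite ge0_ler_powR ?nnegrE ?subr_ge0// ltW.
Qed.

Lemma Wkp3_norm_lt p d w (j : nat) : 4 <= p -> 0 < d -> (j <= 3)%N ->
  measurable_fun I01 (fun t => enorm (weakD3 j w t)) ->
  (Wkp3_norm 3 p w < d%:E)%E ->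
  (\int[mu]_(t in I01) (enorm (weakD3 j w t) ^+ 4)%:E <= (2 * d ^+ 4)%:E)%E.
Proof.
move=> p4 d0 j3 mw nd.
have p0 : 0 < p by apply: lt_le_trans p4.
have pn0 : p != 0 by rewrite gt_eqF.
have Nj : ('N[mu]_(p%:E)[EFin \o ((fun t => enorm (weakD3 j w t)) \_ I01)] <= d%:E)%E.
  apply: le_trans (ltW nd); rewrite /Wkp3_norm.
  have j4 : (j < 4)%N by rewrite ltnS.
  rewrite (bigD1 (Ordinal j4))//= leeDl// sume_ge0// => i _; exact: Lnorm_ge0.
have ip : (\int[mu]_(t in I01) (`|enorm (weakD3 j w t)| `^ p)%:E <= (d `^ p)%:E)%E.
  rewrite -(Lnorm_I01 _ pn0) -poweR_EFin; apply: gt0_ler_poweR => //.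
  - exact: ltW.
  - by rewrite in_itv/= Lnorm_ge0 leey.
  - by rewrite in_itv/= lee_fin (ltW d0) leey.
have mp : measurable_fun I01 (fun t => `|enorm (weakD3 j w t)| `^ p).
  apply: (@measurableT_comp _ _ _ _ _ _ (@powR R ^~ p)) => //.
  exact: measurableT_comp.
apply: (@le_trans _ _ (\int[mu]_(t in I01)
    ((d ^+ 4)%:E + (d `^ (4 - p))%:E * (`|enorm (weakD3 j w t)| `^ p)%:E))%E).
  apply: ge0_le_integral.
  - exact: measurable_I01.
  - by move=> t _; rewrite lee_fin exprn_ge0 ?enorm_ge0.
  - by apply/measurable_EFinP; exact: measurable_funX.
  - apply: emeasurable_funD => //; apply: measurable_funeM.
    exact/measurable_EFinP.
  - move=> t _; rewrite -EFinM -EFinD lee_fin (ger0_norm (enorm_ge0 _)).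
    by apply: pow4_le_powR => //; exact: enorm_ge0.
rewrite ge0_integralD//; last 4 first.
- exact: measurable_I01.
- by move=> t _; rewrite lee_fin exprn_ge0 ?(ltW d0).
- by move=> t _; rewrite -EFinM lee_fin mulr_ge0 ?powR_ge0.
- by apply: measurable_funeM; exact/measurable_EFinP.
rewrite integral_cst; last exact: measurable_I01.
rewrite ge0_integralZl_EFin ?powR_ge0//; last 2 first.
- exact: measurable_I01.
- exact/measurable_EFinP.
(* The interval has measure one, and the exponents 4 - p and p add up to 4. *)
have -> : (2 * d ^+ 4)%:E = ((d ^+ 4)%:E * mu I01 + (d `^ (4 - p))%:E * (d `^ p)%:E)%E.
  rewrite mu_I01 mule1 -EFinM -EFinD -powRD; last by rewrite (gt_eqF d0) implybT.
  rewrite subrK -(@powR_mulrn _ d 4) ?(ltW d0)// mulr2n mulrDl mul1r; reflexivity.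
by rewrite leeD2l// lee_wpmul2l// lee_fin powR_ge0.
Qed.

End SmoothCurves.

(** * Continuity of the Sadowsky functional *)

Section Continuity.
Context {R : realType}.
Notation mu := (@lebesgue_measure R).
Implicit Types (u v y : R -> 'rV[R]_3) (f g h : R -> R).

Lemma ae_integral_comb f g h (al be : R) : 0 <= al -> 0 <= be ->
  measurable_fun I01 f -> measurable_fun I01 g -> measurable_fun I01 h ->
  (forall t, 0 <= f t) -> (forall t, 0 <= g t) -> (forall t, 0 <= h t) ->
  {ae mu, forall t, I01 t -> f t <= al * g t + be * h t} ->
  (\int[mu]_(t in I01) (f t)%:E <=
   al%:E * \int[mu]_(t in I01) (g t)%:E + be%:E * \int[mu]_(t in I01) (h t)%:E)%E.
Proof.
move=> al0 be0 mf mg mh f0 g0 h0 fgh.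
have mI := @measurable_I01 R.
have mag : measurable_fun I01 (fun t => (al * g t)%:E).
  by apply/measurable_EFinP; exact: measurable_funM.
have mbh : measurable_fun I01 (fun t => (be * h t)%:E).
  by apply/measurable_EFinP; exact: measurable_funM.
rewrite -ge0_integralZl_EFin//; last 2 first.
- by move=> t _; rewrite lee_fin.
- exact/measurable_EFinP.
rewrite -ge0_integralZl_EFin//; last 2 first.
- by move=> t _; rewrite lee_fin.
- exact/measurable_EFinP.
rewrite -ge0_integralD//; last 2 first.
- by move=> t _; rewrite -EFinM lee_fin mulr_ge0.
- by move=> t _; rewrite -EFinM lee_fin mulr_ge0.
apply: ae_ge0_le_integral => //.
- by move=> t _; rewrite lee_fin.
- exact/measurable_EFinP.
- by move=> t _; rewrite -!EFinM -EFinD lee_fin addr_ge0// mulr_ge0.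
- exact: emeasurable_funD.
Qed.

Lemma integral_le_add f g h :
  measurable_fun I01 f -> measurable_fun I01 g -> measurable_fun I01 h ->
  (forall t, 0 <= f t) -> (forall t, 0 <= g t) -> (forall t, 0 <= h t) ->
  (forall t, f t <= g t + h t) ->
  (\int[mu]_(t in I01) (f t)%:E <=
   \int[mu]_(t in I01) (g t)%:E + \int[mu]_(t in I01) (h t)%:E)%E.
Proof.
move=> mf mg mh f0 g0 h0 fgh.
rewrite -[X in (_ <= X + _)%E]mul1e -[X in (_ <= _ + X)%E]mul1e.
by apply: ae_integral_comb => //; apply: aeW => t _; rewrite !mul1r.
Qed.

Definition density u (t : R) : R :=
  sadowsky_density (weakD3 1 u t) (weakD3 2 u t) (weakD3 3 u t).

Lemma SadowskyE u : Sadowsky u = (\int[mu]_(t in I01) (density u t)%:E)%E.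
Proof. by []. Qed.

(** The constraints of Y in a form that survives W^{3,p} limits; this is what the comparison of two
    curves asks of each. *)
Definition admissible (km p : R) u := [/\ Wkp3 3 p u,
  {ae mu, forall t, I01 t -> enorm (weakD3 1 u t) = 1} &
  {ae mu, forall t, I01 t -> km <= enorm (weakD3 2 u t)}].

Lemma measurable_eta p u : Wkp3 3 p u -> measurable_fun I01 (Defs.eta u).
Proof.
move=> hu; rewrite /Defs.eta; apply: measurable_funM.
  apply: measurable_dot => i; first exact: (measurable_weakD3 i hu).
  by apply: measurable_cross => j; exact: (measurable_weakD3 j hu).
(* The base is nonnegative, and where it vanishes both the inverse and the power -1 are 0. *)
have -> : (fun t => (enorm (weakD3 2 u t) ^+ 3)^-1) = fun t => (enorm (weakD3 2 u t) ^+ 3) `^ (-1).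
  by apply/funext => t; rewrite powR_inv1// exprn_ge0// enorm_ge0.
apply: (@measurableT_comp _ _ _ _ _ _ (@powR R ^~ (-1))) => //.
by apply: measurable_funX; apply: measurable_enorm => i; exact: (measurable_weakD3 i hu).
Qed.

Lemma measurable_density p u : Wkp3 3 p u -> measurable_fun I01 (density u).
Proof.
move=> hu.
have -> : density u = fun t => curv u t ^+ 2 * (1 + Defs.eta u t ^+ 2) ^+ 2 by [].
apply: measurable_funM; apply: measurable_funX.
  by apply: measurable_enorm => i; exact: (measurable_weakD3 i hu).
apply: measurable_funD => //.
by apply: measurable_funX; exact: measurable_eta hu.
Qed.

Lemma measurable_weakD3B p u v j i : Wkp3 3 p u -> Wkp3 3 p v -> (j <= 3)%N ->
  measurable_fun I01 (fun t => (weakD3 j v t - weakD3 j u t) 0 i).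
Proof.
move=> hu hv j3.
have -> : (fun t => (weakD3 j v t - weakD3 j u t) 0 i) =
    fun t => weakD3 j v t 0 i - weakD3 j u t 0 i.
  by apply/funext => t; rewrite !mxE.
by apply: measurable_funB; [exact: (measurable_weakD3 i hv)|exact: (measurable_weakD3 i hu)].
Qed.

Definition dist4 j u v (t : R) : R := enorm (weakD3 j v t - weakD3 j u t) ^+ 4.

Lemma dist4_ge0 j u v t : 0 <= dist4 j u v t.
Proof. by rewrite exprn_ge0// enorm_ge0. Qed.

Lemma measurable_dist4 p u v j : Wkp3 3 p u -> Wkp3 3 p v -> (j <= 3)%N ->
  measurable_fun I01 (dist4 j u v).
Proof.
move=> hu hv j3; apply: measurable_funX; apply: measurable_enorm => i.
exact: measurable_weakD3B hu hv j3.
Qed.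

Lemma int_dist4 p d u v (j : nat) : 4 <= p -> 0 < d -> (j <= 3)%N ->
  Wkp3 3 p u -> Wkp3 3 p v -> (Wkp3_norm 3 p (v \- u)%R < d%:E)%E ->
  (\int[mu]_(t in I01) (dist4 j u v t)%:E <= (2 * d ^+ 4)%:E)%E.
Proof.
move=> p4 d0 j3 hu hv nd.
have m : measurable_fun I01 (fun t => enorm (weakD3 j (v \- u)%R t)).
  by apply: measurable_enorm => i; exact: (Wkp3B hv hu).
apply: le_trans (Wkp3_norm_lt p4 d0 j3 m nd).
rewrite le_eqVlt; apply/orP; left; apply/eqP.
apply: ae_eq_integral_I01; first exact: measurable_dist4 hu hv j3.
  exact: measurable_funX.
by apply: ae_impl (weakD3B hv hu j3) => t h It; rewrite (h It).
Qed.

Definition tail (T : R) u (t : R) : R :=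
  if enorm (weakD3 3 u t) <= T then 0 else enorm (weakD3 3 u t) ^+ 4.

Lemma tail_ge0 T u t : 0 <= tail T u t.
Proof. by rewrite /tail; case: ifP => // _; rewrite exprn_ge0// enorm_ge0. Qed.

Lemma measurable_tail p T u : Wkp3 3 p u -> measurable_fun I01 (tail T u).
Proof.
move=> hu; have m : measurable_fun I01 (fun t => enorm (weakD3 3 u t)).
  by apply: measurable_enorm => i; exact: (measurable_weakD3 i hu).
apply: measurable_fun_if => //.
- exact: measurable_I01.
- exact: measurable_fun_ler.
- apply: (@measurable_funS _ _ _ _ I01); [exact: measurable_I01|exact: subIsetl|].
  exact: measurable_funX.
Qed.

(** The right-hand side of [planar_diff] without its constant, with [u] as the reference curve: only
    its third derivative is truncated. *)
Definition compare_error (T : R) u v (t : R) : R :=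
  (1 + T ^+ 4) * (dist4 1 u v t + dist4 2 u v t) + dist4 3 u v t + tail T u t.

Lemma err_ge0 T u v t : 0 <= T -> 0 <= compare_error T u v t.
Proof.
move=> T0; rewrite /compare_error.
move: (dist4_ge0 1 u v t) (dist4_ge0 2 u v t) (dist4_ge0 3 u v t) (tail_ge0 T u t).
move: (dist4 1 u v t) (dist4 2 u v t) (dist4 3 u v t) (tail T u t) => x y z w x0 y0 z0 w0.
by rewrite addr_ge0// addr_ge0// mulr_ge0// ?addr_ge0// exprn_ge0.
Qed.

Lemma measurable_err p T u v : Wkp3 3 p u -> Wkp3 3 p v -> measurable_fun I01 (compare_error T u v).
Proof.
move=> hu hv; apply: measurable_funD; last exact: measurable_tail hu.
apply: measurable_funD; last exact: measurable_dist4 hu hv _.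
apply: measurable_funM => //.
by apply: measurable_funD; exact: measurable_dist4 hu hv _.
Qed.

Lemma int_err p T d u v : 4 <= p -> 0 < d -> 0 <= T ->
  Wkp3 3 p u -> Wkp3 3 p v -> (Wkp3_norm 3 p (v \- u)%R < d%:E)%E ->
  (\int[mu]_(t in I01) (compare_error T u v t)%:E <=
    ((1 + T ^+ 4) * (4 * d ^+ 4) + 2 * d ^+ 4)%:E + \int[mu]_(t in I01) (tail T u t)%:E)%E.
Proof.
move=> p4 d0 T0 hu hv nd.
have i1 := int_dist4 p4 d0 (isT : (1 <= 3)%N) hu hv nd.
have i2 := int_dist4 p4 d0 (isT : (2 <= 3)%N) hu hv nd.
have i3 := int_dist4 p4 d0 (isT : (3 <= 3)%N) hu hv nd.
have m1 := measurable_dist4 hu hv (isT : (1 <= 3)%N).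
have m2 := measurable_dist4 hu hv (isT : (2 <= 3)%N).
have m3 := measurable_dist4 hu hv (isT : (3 <= 3)%N).
have mt := measurable_tail T hu.
have T40 : 0 <= 1 + T ^+ 4 by rewrite addr_ge0// exprn_ge0.
have m12 : measurable_fun I01 (fun t => dist4 1 u v t + dist4 2 u v t) := measurable_funD m1 m2.
have m3t : measurable_fun I01 (fun t => dist4 3 u v t + tail T u t) := measurable_funD m3 mt.
have d12 t : 0 <= dist4 1 u v t + dist4 2 u v t by apply: addr_ge0; exact: dist4_ge0.
have d3t t : 0 <= dist4 3 u v t + tail T u t.
  by apply: addr_ge0; [exact: dist4_ge0|exact: tail_ge0].
have I12 : (\int[mu]_(t in I01) (dist4 1 u v t + dist4 2 u v t)%:E <= (4 * d ^+ 4)%:E)%E.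
  have -> : (4 * d ^+ 4)%:E = ((2 * d ^+ 4)%:E + (2 * d ^+ 4)%:E)%E.
    by rewrite -EFinD; congr EFin; ring.
  apply: le_trans (leeD i1 i2).
  exact: integral_le_add m12 m1 m2 d12 (dist4_ge0 1 u v) (dist4_ge0 2 u v) (fun t => lexx _).
have I3t := integral_le_add m3t m3 mt d3t (dist4_ge0 3 u v) (tail_ge0 T u) (fun t => lexx _).
have key : {ae mu, forall t, I01 t -> compare_error T u v t <=
    (1 + T ^+ 4) * (dist4 1 u v t + dist4 2 u v t) + 1 * (dist4 3 u v t + tail T u t)}.
  apply: aeW => t _; rewrite /compare_error.
  move: (dist4 1 u v t) (dist4 2 u v t) (dist4 3 u v t) (tail T u t) => x y z w.
  by rewrite mul1r addrA.
have me := measurable_err T hu hv.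
apply: (le_trans (ae_integral_comb T40 ler01 me m12 m3t (fun t => err_ge0 u v t T0) d12 d3t key)).
rewrite [X in (_ <= X + _)%E]EFinD -addeA; apply: leeD.
  by rewrite EFinM; apply: lee_wpmul2l.
rewrite mul1e; apply: (le_trans I3t); exact: leeD.
Qed.

(** The squared planar distance is symmetric in the two curves, so one error term, with the tail of
    [u] alone, serves both directions. Infinite values are allowed. *)
Lemma Sadowsky_compare (km p : R) : 0 < km -> exists2 C, 0 < C &
  forall (s T : R) u v, 0 < s -> 0 <= T -> admissible km p u -> admissible km p v ->
  (Sadowsky v <= ((1 + s) ^+ 3)%:E * Sadowsky u +
     ((1 + s^-1) ^+ 3 * C)%:E * \int[mu]_(t in I01) (compare_error T u v t)%:E)%E /\
  (Sadowsky u <= ((1 + s) ^+ 3)%:E * Sadowsky v +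
     ((1 + s^-1) ^+ 3 * C)%:E * \int[mu]_(t in I01) (compare_error T u v t)%:E)%E.
Proof.
move=> km0; have [C C0 hC] := planar_diff km0; exists C => //.
move=> s T u v s0 T0 [hu u1 u2] [hv v1 v2].
have a0 : 0 <= (1 + s) ^+ 3 by rewrite exprn_ge0// addr_ge0// ltW.
have b0 : 0 <= (1 + s^-1) ^+ 3 by rewrite exprn_ge0// addr_ge0// invr_ge0 ltW.
have bC0 : 0 <= (1 + s^-1) ^+ 3 * C by rewrite mulr_ge0// ltW.
have key : {ae mu, forall t, I01 t ->
    density v t <= (1 + s) ^+ 3 * density u t + (1 + s^-1) ^+ 3 * C * compare_error T u v t /\
    density u t <= (1 + s) ^+ 3 * density v t + (1 + s^-1) ^+ 3 * C * compare_error T u v t}.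
  apply: ae_impl2 (ae_impl2 (fun t => @conj _ _) u1 u2) (ae_impl2 (fun t => @conj _ _) v1 v2).
  move=> t [a1 b1] [a'1 b'1] It.
  have kb := b1 It; have kb' := b'1 It.
  have := hC T _ _ (weakD3 3 u t) _ _ (weakD3 3 v t) T0 (a1 It) (a'1 It) kb kb'.
  have pb := lt_le_trans km0 kb; have pb' := lt_le_trans km0 kb'.
  rewrite /density (sadowsky_densityE _ _ pb) (sadowsky_densityE _ _ pb').
  set x := Num.sqrt _; set y := twist _ _ _; set x' := Num.sqrt _; set y' := twist _ _ _.
  move=> h; split; [apply: (le_trans (sqr_sum_young x' y' x y s0))|apply: (le_trans (sqr_sum_young x y x' y' s0))].
    by rewrite lerD2l -mulrA ler_wpM2l.
  have sqC (z w : R) : (z - w) ^+ 2 = (w - z) ^+ 2 by rewrite -sqrrN opprB.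
  by rewrite (sqC x' x) (sqC y' y) lerD2l -mulrA; exact: ler_wpM2l.
have mdu := measurable_density hu; have mdv := measurable_density hv.
have me := measurable_err T hu hv.
have du0 t : 0 <= density u t by exact: sadowsky_density_ge0.
have dv0 t : 0 <= density v t by exact: sadowsky_density_ge0.
have e0 t : 0 <= compare_error T u v t by exact: err_ge0.
rewrite !SadowskyE; split.
- apply: (ae_integral_comb a0 bC0 mdv mdu me dv0 du0 e0).
  by apply: ae_impl key => t h It; exact: (h It).1.
- apply: (ae_integral_comb a0 bC0 mdu mdv me du0 dv0 e0).
  by apply: ae_impl key => t h It; exact: (h It).2.
Qed.

Lemma ae_zero (q : R -> R) : measurable_fun I01 q ->
  (forall d : R, 0 < d -> (\int[mu]_(t in I01) (q t ^+ 4)%:E <= (2 * d ^+ 4)%:E)%E) ->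
  {ae mu, forall t, I01 t -> q t = 0}.
Proof.
move=> mq hq.
have q40 t : 0 <= q t ^+ 4 by rewrite (_ : 4%N = (2 * 2)%N)// exprM sqr_ge0.
have mq4 : measurable_fun I01 (fun t => (q t ^+ 4)%:E).
  by apply/measurable_EFinP; exact: measurable_funX.
have i0 : (\int[mu]_(t in I01) (q t ^+ 4)%:E = 0)%E.
  apply/eqP; rewrite eq_le; apply/andP; split; last first.
    by apply: integral_ge0 => t _; rewrite lee_fin.
  apply/lee_addgt0Pr => e e0; rewrite add0e.
  (* As d is at most 1, d^4 is at most d, so 2 d^4 is at most e. *)
  pose d := Num.min 1 (e / 2).
  have d0 : 0 < d by rewrite lt_min ltr01 divr_gt0.
  apply: (le_trans (hq d d0)); rewrite lee_fin -ler_pdivlMl// mulrC.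
  apply: (@le_trans _ _ d); last by rewrite ge_min lexx orbT.
  rewrite exprS ler_piMr ?(ltW d0)// exprn_ile1 ?(ltW d0)//.
  by rewrite ge_min lexx.
have : (\int[mu]_(t in I01) `|(q t ^+ 4)%:E| = 0)%E.
  by rewrite -[RHS]i0; apply: eq_integral => t _; rewrite gee0_abs// lee_fin.
move=> /(ae_eq_integral_abs _ (@measurable_I01 R) mq4).
apply: ae_impl => t h It; have := h It.
by move=> /= [] /eqP; rewrite expf_eq0/= => /eqP.
Qed.

Lemma Ykm_smooth A B (km : R) y : Ykm A B km y -> smooth01 y.
Proof. by move=> [[]]. Qed.

Lemma Ykm_adm A B (km p : R) y : 0 < p -> Ykm A B km y -> admissible km p y.
Proof.
move=> p0 hy; have sy := Ykm_smooth hy; have [[_ _ _ y1] y2] := hy; split.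
- exact: smooth01_Wkp3.
- by apply: ae_impl (smooth01_weakD3 1 sy) => t h It; rewrite (h It); exact: y1.
- by apply: ae_impl (smooth01_weakD3 2 sy) => t h It; rewrite (h It); exact: y2.
Qed.

Lemma Ykm_Xkmp A B (km p : R) y : 0 < p -> Ykm A B km y -> Xkmp A B km p y.
Proof.
move=> p0 hy; have hW : Wkp3 3 p y by apply: smooth01_Wkp3 => //; exact: Ykm_smooth hy.
split => // e e0; exists y => //.
by rewrite Wkp3_norm0// lte_fin.
Qed.

(** The amount q by which u violates a constraint is at most the pointwise distance of its
    derivative to that of any curve of Y. Hence the integral of q^4 is arbitrarily small, and q
    vanishes almost everywhere. *)
Lemma Xkmp_adm A B (km p : R) u : 4 <= p -> Xkmp A B km p u -> admissible km p u.
Proof.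
move=> p4 [hu happ]; have p0 : 0 < p by apply: lt_le_trans p4.
have approx (q : R -> R) (j : nat) : (j <= 3)%N -> measurable_fun I01 q ->
    (forall y, Ykm A B km y -> {ae mu, forall t, I01 t -> q t ^+ 4 <= dist4 j y u t}) ->
    {ae mu, forall t, I01 t -> q t = 0}.
  move=> j3 mq hq; apply: ae_zero => // d d0.
  have [y hy nd] := happ d d0.
  have hW : Wkp3 3 p y by apply: smooth01_Wkp3 => //; exact: Ykm_smooth hy.
  apply: le_trans (int_dist4 p4 d0 j3 hW hu nd).
  apply: ae_ge0_le_integral.
  - exact: measurable_I01.
  - by move=> t _; rewrite lee_fin (_ : 4%N = (2 * 2)%N)// exprM sqr_ge0.
  - by apply/measurable_EFinP; exact: measurable_funX.
  - by move=> t _; rewrite lee_fin dist4_ge0.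
  - by apply/measurable_EFinP; exact: measurable_dist4 hW hu j3.
  - by apply: ae_impl (hq _ hy) => t h It; rewrite lee_fin; exact: h.
have m j : (j <= 3)%N -> measurable_fun I01 (fun t => enorm (weakD3 j u t)).
  by move=> j3; apply: measurable_enorm => i; exact: (measurable_weakD3 i hu).
split => //.
- have : {ae mu, forall t, I01 t -> `|enorm (weakD3 1 u t) - 1| = 0}.
    apply: (approx _ 1%N) => //.
      by apply: measurableT_comp => //; apply: measurable_funB => //; exact: m.
    move=> y hy; have [_ y1 _] := Ykm_adm p0 hy.
    apply: ae_impl y1 => t h It; rewrite ler_pXn2r ?nnegrE ?enorm_ge0//.
    by rewrite -(h It) enorm_dist.
  by apply: ae_impl => t h It; apply/eqP; rewrite -subr_eq0 -normr_eq0 h.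
- have : {ae mu, forall t, I01 t -> Num.max 0 (km - enorm (weakD3 2 u t)) = 0}.
    apply: (approx _ 2%N) => //.
      by apply: measurable_maxr => //; apply: measurable_funB => //; exact: m.
    move=> y hy; have [_ _ y2] := Ykm_adm p0 hy.
    apply: ae_impl y2 => t h It; rewrite ler_pXn2r ?nnegrE ?enorm_ge0// ?le_max ?lexx//.
    rewrite ge_max enorm_ge0/= lerBlDr (le_trans (h It))// -lerBlDr.
    by rewrite (le_trans (ler_norm _))// enormBC enorm_dist.
  apply: ae_impl => t h It; have /eqP := h It.
  by rewrite eq_maxl subr_le0.
Qed.

End Continuity.

(** * Finiteness and continuity on the closure of the smooth curves *)

Section Continuity2.
Context {R : realType}.
Notation mu := (@lebesgue_measure R).
Implicit Types (u v y : R -> 'rV[R]_3) (f g h : R -> R).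

Lemma enorm_le1D (v : 'rV[R]_3) : enorm v <= 1 + dot v v.
Proof.
rewrite -sqr_enorm; have := enorm_ge0 v; move: (enorm v) => x x0.
have := sqr_ge0 (x - 1); lra.
Qed.

Lemma smooth01_enorm_bdd y j : smooth01 y ->
  exists2 M, 0 <= M & forall t, I01 t -> enorm (derive1n j y t) <= M.
Proof.
move=> sy; have [_ dy _ _] := sy.
have b i : bdd (fun t => derive1n j y t 0 i).
  have [_ _ [M hM] _] := smooth01_c1b j i sy; exists M => t It.
  by rewrite derive1n_coord// hM.
have [M hM] := bddD (bddD (bddM (b 0) (b 0)) (bddM (b 1) (b 1))) (bddM (b (1 + 1)) (b (1 + 1))).
exists (1 + `|M|); first by rewrite addr_ge0.
move=> t It; rewrite (le_trans (enorm_le1D _))// lerD2l dotE.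
by rewrite (le_trans (ler_norm _))// (le_trans (hM _ It))// ler_norm.
Qed.

Lemma integral_le_cst (f : R -> R) (M : R) : 0 <= M -> measurable_fun I01 f ->
  (forall t, 0 <= f t) -> {ae mu, forall t, I01 t -> f t <= M} ->
  (\int[mu]_(t in I01) (f t)%:E <= M%:E)%E.
Proof.
move=> M0 mf f0 fM.
apply: (@le_trans _ _ (\int[mu]_(t in I01) (cst M%:E t))%E).
  apply: ae_ge0_le_integral => //.
  - exact: measurable_I01.
  - by move=> t _; rewrite lee_fin.
  - exact/measurable_EFinP.
rewrite integral_cst; last exact: measurable_I01.
have e : (@lebesgue_measure R : {measure set _ -> \bar R}) I01 = 1%E := @mu_I01 R.
by rewrite e mule1.
Qed.

Lemma density_le (k M : R) (a b c : 'rV[R]_3) : 0 < k -> 0 <= M ->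
  enorm a = 1 -> k <= enorm b -> enorm b <= M -> enorm c <= M ->
  sadowsky_density a b c <= M ^+ 2 * (1 + (M / k ^+ 2) ^+ 2) ^+ 2.
Proof.
move=> k0 M0 a1 kb bM cM; have b0 : 0 < enorm b by apply: lt_le_trans kb.
have h : `|trip a b c / enorm b ^+ 3| <= M / k ^+ 2.
  rewrite normrM normfV (ger0_norm (exprn_ge0 3 (enorm_ge0 b))).
  apply: (@le_trans _ _ ((enorm b * enorm c) / enorm b ^+ 3)).
    by rewrite ler_wpM2r ?invr_ge0 ?exprn_ge0 ?(ltW b0)// (le_trans (trip_le _ _ _))// a1 mul1r.
  have -> : enorm b * enorm c / enorm b ^+ 3 = enorm c / enorm b ^+ 2.
    by field; rewrite gt_eqF.
  rewrite ler_pM ?enorm_ge0 ?invr_ge0 ?exprn_ge0 ?(ltW b0)//.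
  by rewrite lef_pV2 ?posrE ?exprn_gt0// ler_pXn2r ?nnegrE ?(ltW k0) ?(ltW b0).
have h2 : (trip a b c / enorm b ^+ 3) ^+ 2 <= (M / k ^+ 2) ^+ 2.
  rewrite -(real_normK (num_real (trip a b c / enorm b ^+ 3))).
  by rewrite ler_pXn2r// nnegrE ?(le_trans _ h).
have x0 := sqr_ge0 (trip a b c / enorm b ^+ 3).
rewrite /sadowsky_density; move: h2 x0; set x := (_ / _) ^+ 2; set z := (_ / _) ^+ 2 => xz x0.
have z0 : 0 <= z by apply: le_trans xz.
rewrite ler_pM ?sqr_ge0//.
  by rewrite ler_pXn2r// nnegrE enorm_ge0.
by rewrite ler_pXn2r ?nnegrE ?addr_ge0// lerD2l.
Qed.

Lemma Ykm_bounds A B (km : R) y : Ykm A B km y -> exists2 M, 0 <= M &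
  {ae mu, forall t, I01 t -> enorm (weakD3 2 y t) <= M /\ enorm (weakD3 3 y t) <= M}.
Proof.
move=> hy; have sy := Ykm_smooth hy.
have [M2 M20 h2] := smooth01_enorm_bdd 2 sy.
have [M3 M30 h3] := smooth01_enorm_bdd 3 sy.
exists (M2 + M3); first exact: addr_ge0.
apply: ae_impl2 (smooth01_weakD3 2 sy) (smooth01_weakD3 3 sy) => t e2 e3 It.
rewrite (e2 It) (e3 It); split.
  by rewrite (le_trans (h2 _ It))// lerDl.
by rewrite (le_trans (h3 _ It))// lerDr.
Qed.

Lemma Sadowsky_Ykm_lty A B (km p : R) y : 0 < km -> 0 < p -> Ykm A B km y ->
  (Sadowsky y < +oo)%E.
Proof.
move=> km0 p0 hy; have [M M0 hM] := Ykm_bounds hy.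
have [hW y1 y2] := Ykm_adm p0 hy.
apply: (@le_lt_trans _ _ (M ^+ 2 * (1 + (M / km ^+ 2) ^+ 2) ^+ 2)%:E); last exact: ltry.
rewrite SadowskyE; apply: integral_le_cst.
- by rewrite mulr_ge0// sqr_ge0.
- exact: measurable_density hW.
- by move=> t; exact: sadowsky_density_ge0.
apply: ae_impl2 (ae_impl2 (fun t => @conj _ _) y1 y2) hM => t [h1 h2] h It.
by have [b2 b3] := h It; exact: density_le (h1 It) (h2 It) b2 b3.
Qed.

Lemma int_tail_Ykm A B (km p T : R) y : 0 < p -> Ykm A B km y ->
  (\int[mu]_(t in I01) (tail T y t)%:E < +oo)%E.
Proof.
move=> p0 hy; have [M M0 hM] := Ykm_bounds hy.
have [hW y1 y2] := Ykm_adm p0 hy.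
apply: (@le_lt_trans _ _ (M ^+ 4)%:E); last exact: ltry.
apply: integral_le_cst.
- exact: exprn_ge0.
- exact: measurable_tail hW.
- exact: tail_ge0.
apply: ae_impl hM => t h It; have [_ b3] := h It.
rewrite /tail; case: ifP => _; first exact: exprn_ge0.
by rewrite ler_pXn2r// nnegrE enorm_ge0.
Qed.

Lemma Sadowsky_Xkmp_lty A B (km p : R) u : 0 < km -> 4 <= p -> Xkmp A B km p u ->
  (Sadowsky u < +oo)%E.
Proof.
move=> km0 p4 hu; have p0 : 0 < p by apply: lt_le_trans p4.
have au := Xkmp_adm p4 hu; have [hWu happ] := hu.
have [y hy nd] := happ 1 ltr01.
have ay := Ykm_adm p0 hy; have [hWy _ _] := ay.
have [C C0 hC] := Sadowsky_compare p km0.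
(* The smooth curve is the reference here, so that the tail in the error is bounded and even T = 0
   will do. *)
have [h _] := hC 1 0 y u ltr01 (lexx _) ay au.
apply: (le_lt_trans h); apply: lte_add_pinfty; apply: lte_mul_pinfty => //.
- exact: Sadowsky_Ykm_lty km0 p0 hy.
- by rewrite lee_fin mulr_ge0// ltW.
- apply: (le_lt_trans (int_err p4 ltr01 (lexx 0) hWy hWu nd)).
  by apply: lte_add_pinfty; [exact: ltry|exact: int_tail_Ykm p0 hy].
Qed.

(** u''' differs by an L^4 function from the bounded third derivative of a smooth curve at distance
    less than 1. *)
Lemma int_D3_lty A B (km p : R) u : 4 <= p -> Xkmp A B km p u ->
  (\int[mu]_(t in I01) (enorm (weakD3 3 u t) ^+ 4)%:E < +oo)%E.
Proof.
move=> p4 hu; have p0 : 0 < p by apply: lt_le_trans p4.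
have [hWu happ] := hu; have [y hy nd] := happ 1 ltr01.
have [hWy _ _] := Ykm_adm p0 hy; have [M M0 hM] := Ykm_bounds hy.
have mu3 : measurable_fun I01 (fun t => enorm (weakD3 3 u t) ^+ 4).
  by apply: measurable_funX; apply: measurable_enorm => i; exact: (measurable_weakD3 i hWu).
have md := measurable_dist4 hWy hWu (isT : (3 <= 3)%N).
have m1 : measurable_fun I01 (cst 1 : R -> R) by [].
have u0 t : 0 <= enorm (weakD3 3 u t) ^+ 4 by rewrite exprn_ge0// enorm_ge0.
have M4 : 0 <= 8 * M ^+ 4 by rewrite mulr_ge0// exprn_ge0.
have key : {ae mu, forall t, I01 t ->
    enorm (weakD3 3 u t) ^+ 4 <= 8 * dist4 3 y u t + 8 * M ^+ 4 * (cst 1 : R -> R) t}.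
  apply: ae_impl hM => t h It; have [_ h3] := h It.
  rewrite /dist4 /cst mulr1 -mulrDr.
  apply: (@le_trans _ _ ((enorm (weakD3 3 u t - weakD3 3 y t) + M) ^+ 4)); last exact: pow4D.
  rewrite ler_pXn2r ?nnegrE ?addr_ge0 ?enorm_ge0//.
  rewrite -[X in enorm X <= _](subrK (weakD3 3 y t)) (le_trans (enormD _ _))//.
  by rewrite lerD2l.
have h80 : 0 <= 8 :> R by [].
apply: (le_lt_trans (ae_integral_comb h80 M4 mu3 md m1 u0 (dist4_ge0 3 y u) (fun=> ler01) key)).
apply: lte_add_pinfty; apply: lte_mul_pinfty => //.
- by apply: (le_lt_trans (int_dist4 p4 ltr01 (isT : (3 <= 3)%N) hWy hWu nd)); exact: ltry.
- apply: (@le_lt_trans _ _ 1%E); last exact: ltry.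
  by apply: (integral_le_cst ler01 m1 (fun=> ler01)); exact: aeW.
Qed.

(** At each t the tail is 0 as soon as T exceeds |u'''(t)|, and |u'''|^4 dominates; dominated
    convergence along integer T concludes. *)
Lemma tail_small A B (km p : R) u (e : R) : 4 <= p -> Xkmp A B km p u -> 0 < e ->
  exists2 T, 0 <= T & (\int[mu]_(t in I01) (tail T u t)%:E <= e%:E)%E.
Proof.
move=> p4 hu e0; have p0 : 0 < p by apply: lt_le_trans p4.
have [hWu _] := hu.
have mu3 : measurable_fun I01 (fun t => (enorm (weakD3 3 u t) ^+ 4)%:E).
  apply/measurable_EFinP.
  by apply: measurable_funX; apply: measurable_enorm => i; exact: (measurable_weakD3 i hWu).
have u0 t : 0 <= enorm (weakD3 3 u t) ^+ 4 by rewrite exprn_ge0// enorm_ge0.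
have ig : mu.-integrable I01 (fun t => (enorm (weakD3 3 u t) ^+ 4)%:E).
  apply/integrableP; split => //.
  under eq_integral do rewrite gee0_abs ?lee_fin//.
  exact: int_D3_lty p4 hu.
have mf_ n : measurable_fun I01 (fun t => (tail n%:R u t)%:E).
  by apply/measurable_EFinP; exact: measurable_tail hWu.
have mf : measurable_fun I01 (cst 0%E : R -> \bar R) by [].
have cv : {ae mu, forall t, I01 t -> (fun n => (tail n%:R u t)%:E) @ \oo --> (cst 0%E : R -> \bar R) t}.
  apply: aeW => t _; apply: cvg_near_cst.
  near=> n; rewrite /tail ifT//.
  by near: n; exact: nbhs_infty_ger.
have dom : {ae mu, forall t (n : nat), I01 t ->
    (`|(tail n%:R u t)%:E| <= (enorm (weakD3 3 u t) ^+ 4)%:E)%E}.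
  apply: aeW => t n _; rewrite gee0_abs ?lee_fin ?tail_ge0//.
  by rewrite /tail; case: ifP.
have [_ _ h] := @dominated_convergence _ _ _ mu _ (@measurable_I01 R) _ _ _ mf_ mf cv ig dom.
rewrite integral0 in h.
have : \forall n \near \oo, (\int[mu]_(t in I01) (tail n%:R u t)%:E < e%:E)%E.
  apply: (h [set y | (y < e%:E)%E]).
  by apply: open_nbhs_nbhs; split; [exact: open_ereal_lt_ereal|rewrite /= lte_fin].
by move=> [N _ hN]; exists N%:R => //; apply/ltW/hN => /=.
Unshelve. all: by end_near. Qed.

(** The parameters are fixed in the order s, T, d: s brings the leading factor close to 1, T
    compensates the large factor in 1/s on the tail, and d compensates both that factor and T^4. *)
Lemma Sadowsky_continuous A B (km p : R) u (e : R) : 0 < km -> 4 <= p ->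
  Xkmp A B km p u -> 0 < e -> exists2 d, 0 < d & forall v, Xkmp A B km p v ->
    (Wkp3_norm 3 p (v \- u)%R < d%:E)%E ->
    (Sadowsky v <= Sadowsky u + e%:E)%E /\ (Sadowsky u <= Sadowsky v + e%:E)%E.
Proof.
move=> km0 p4 hu e0.
have au := Xkmp_adm p4 hu; have [hWu _] := hu.
have S0 (w : R -> 'rV[R]_3) : (0 <= Sadowsky w)%E.
  by apply: integral_ge0 => t _; rewrite lee_fin; exact: sadowsky_density_ge0.
have [C C0 hC] := Sadowsky_compare p km0.
have : Sadowsky u \is a fin_num.
  by rewrite ge0_fin_numE//; exact: Sadowsky_Xkmp_lty km0 p4 hu.
case Eu : (Sadowsky u) (S0 u) => [x| |] // + _; rewrite lee_fin => x0.
(* For s at most 1, (1 + s)^3 is at most 1 + 7 s; the 14 then makes 7 s x at most e / 2. *)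
pose s := Num.min 1 (e / (14 * (x + 1))).
have x1 : 0 < 14 * (x + 1) by lra.
have s0 : 0 < s by rewrite lt_min ltr01 divr_gt0.
have s1 : s <= 1 by rewrite ge_min lexx.
have sx : s * (14 * (x + 1)) <= e by rewrite -ler_pdivlMr// ge_min lexx orbT.
have s7 : (1 + s) ^+ 3 <= 1 + 7 * s.
  have h1 : s ^+ 2 <= s by rewrite expr2 ler_piMr// ltW.
  have h2 : s ^+ 3 <= s by rewrite exprS ler_piMr ?(ltW s0)// exprn_ile1// ltW.
  have -> : (1 + s) ^+ 3 = 1 + 3 * s + 3 * s ^+ 2 + s ^+ 3 by ring.
  lra.
pose be := (1 + s^-1) ^+ 3 * C.
have be0 : 0 < be by rewrite mulr_gt0// exprn_gt0// addr_gt0// invr_gt0.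
have [T T0 hT] := @tail_small A B km p u (e / (4 * be)) p4 hu (ltac:(by rewrite divr_gt0// mulr_gt0)).
(* 6 + 4 T^4 = 4 (1 + T^4) + 2 collects the coefficients of d^4 in [int_err]; this part of the error
   costs e / 4, and the tail another e / 4. *)
pose D := 4 * be * (6 + 4 * T ^+ 4).
have T4 : 0 <= T ^+ 4 by rewrite exprn_ge0.
have T6 : 0 < 6 + 4 * T ^+ 4 by lra.
have D0 : 0 < D by apply: mulr_gt0 => //; exact: mulr_gt0.
pose d := Num.min 1 (e / D).
have d0 : 0 < d by rewrite lt_min ltr01 divr_gt0.
have d1 : d <= 1 by rewrite ge_min lexx.
have dD : d * D <= e by rewrite -ler_pdivlMr// ge_min lexx orbT.
have d4 : d ^+ 4 <= d by rewrite exprS ler_piMr ?(ltW d0)// exprn_ile1// ltW.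
exists d => // v hv nd.
have av := Xkmp_adm p4 hv; have [hWv _] := hv.
have [h1 h2] := hC s T u v s0 T0 au av.
have E : (be%:E * \int[mu]_(t in I01) (compare_error T u v t)%:E <= (e / 2)%:E)%E.
  apply: (@le_trans _ _ (be%:E * ((1 + T ^+ 4) * (4 * d ^+ 4) + 2 * d ^+ 4 + e / (4 * be))%:E)%E).
    apply: lee_wpmul2l; first by rewrite lee_fin ltW.
    by rewrite EFinD; apply: (le_trans (int_err p4 d0 T0 hWu hWv nd)); exact: leeD2l.
  rewrite -EFinM lee_fin.
  have -> : be * ((1 + T ^+ 4) * (4 * d ^+ 4) + 2 * d ^+ 4 + e / (4 * be)) =
      d ^+ 4 * (be * (6 + 4 * T ^+ 4)) + e / 4 by field; rewrite gt_eqF.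
  have : d ^+ 4 * (be * (6 + 4 * T ^+ 4)) <= d * (be * (6 + 4 * T ^+ 4)).
    by rewrite ler_wpM2r// mulr_ge0 ?(ltW be0)//; lra.
  rewrite /D in dD; lra.
have sxe (z : R) : 0 <= z -> z <= x -> (1 + s) ^+ 3 * z <= z + e / 2.
  move=> z0 zx; apply: (@le_trans _ _ ((1 + 7 * s) * z)); first by rewrite ler_wpM2r.
  have : s * z <= s * x by rewrite ler_wpM2l// ltW.
  lra.
rewrite -/be in h1 h2; split.
- apply: (le_trans h1); rewrite Eu (_ : e = e / 2 + e / 2); last by field.
  rewrite EFinD addeA; apply: leeD => //.
  by rewrite -EFinM -EFinD lee_fin sxe.
(* The leading factor now multiplies the value at v, which [sxe] controls only up to x; beyond x the
   inequality is immediate. *)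
- have [uv|vu] := leP x%:E (Sadowsky v).
    by apply: (le_trans uv); rewrite leeDl// lee_fin ltW.
  rewrite -Eu; apply: (le_trans h2); rewrite (_ : e = e / 2 + e / 2); last by field.
  rewrite EFinD addeA; apply: leeD => //.
  have := S0 v; move: vu; case: (Sadowsky v) => [z| |]//.
  rewrite lte_fin lee_fin => zx z0.
  by rewrite -EFinM -EFinD lee_fin sxe// ltW.
Qed.

End Continuity2.

(** * The weight g *)

Section WeightAndLimits.
Context {R : realType}.

(** The difference of the two sides vanishes at 0 and has derivative t^2 / (4 - t^2). *)
Lemma ln_ratio_ge (x : R) : 0 < x < 2 -> x <= ln ((2 + x) / (2 - x)).
Proof.
move=> /andP[x0 x2].
pose f (t : R) := ln (2 + t) - ln (2 - t) - t.
have df (t : R) : 0 <= t <= x -> is_derive t 1 f ((2 + t)^-1 + (2 - t)^-1 - 1).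
  move=> /andP[t0 tx].
  have p1 : 0 < 2 + t by lra.
  have p2 : 0 < 2 - t by lra.
  have d1 : is_derive t 1 (fun t : R => 2 + t) 1.
    apply: (is_derive_eq (is_deriveD (is_derive_cst (2 : R) t 1) (is_derive_id t 1))).
    by rewrite add0r.
  have d2 : is_derive t 1 (fun t : R => 2 - t) (-1).
    apply: (is_derive_eq (is_deriveB (is_derive_cst (2 : R) t 1) (is_derive_id t 1))).
    by rewrite sub0r.
  have l1 := @is_derive1_comp R (@ln R) (fun t : R => 2 + t) t _ _ (is_derive1_ln p1) d1.
  have l2 := @is_derive1_comp R (@ln R) (fun t : R => 2 - t) t _ _ (is_derive1_ln p2) d2.
  apply: (is_derive_eq (is_deriveB (is_deriveB l1 l2) (is_derive_id t 1))).
  by rewrite mulr1 mulrN1 opprK.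
have f0 : f 0 = 0 by rewrite /f addr0 !subr0 subrr.
have : f 0 <= f x.
  apply: (@ger0_derive1_ndecr R f 0 x) => //; last exact: ltW.
  - move=> t; rewrite in_itv/= => /andP[t0 tx].
    by have [] := df t; rewrite ?(ltW t0) ?(ltW tx).
  - move=> t; rewrite in_itv/= => /andP[t0 tx].
    rewrite derive1E (@derive_val _ _ _ _ _ _ _ (df t _)); last by rewrite (ltW t0) (ltW tx).
    have -> : (2 + t)^-1 + (2 - t)^-1 - 1 = t ^+ 2 / ((2 + t) * (2 - t)).
      by field; rewrite !gt_eqF//; lra.
    by rewrite mulr_ge0 ?sqr_ge0// invr_ge0 mulr_ge0//; lra.
  - apply: derivable_within_continuous => t; rewrite in_itv/= => /df[]//.
rewrite f0 /f subr_ge0 -ln_div// posrE; lra.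
Qed.

(** This is ln (1 + z) <= z at z = 2 x / (2 - x). *)
Lemma ln_ratio_le (x : R) : 0 < x < 2 -> ln ((2 + x) / (2 - x)) <= x * (2 / (2 - x)).
Proof.
move=> /andP[x0 x2]; have p : 0 < 2 - x by lra.
have -> : (2 + x) / (2 - x) = 1 + x * (2 / (2 - x)) by field; rewrite gt_eqF.
by apply: le_ln1Dx; apply: (lt_trans (ltrN10 _)); rewrite mulr_gt0// divr_gt0.
Qed.

Lemma gW_even (x : R) : gW (- x) = gW x.
Proof.
rewrite /gW oppr_eq0 normrN; case: ifP => // _; case: ifP => // x2; congr EFin.
have /andP[h1 h2] : - 2 < x < 2 by rewrite -ltr_norml.
have p1 : 0 < 2 + x by lra.
have p2 : 0 < 2 - x by lra.
rewrite opprK -[in RHS](invf_div (2 - x)) lnV ?posrE ?divr_gt0//.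
by rewrite invrN mulNr mulrN.
Qed.

Lemma gW_abs (x : R) : gW x = gW `|x|.
Proof. by have [x0|x0] := ger0P x => //; rewrite gW_even. Qed.

Lemma gW_ge1 (x : R) : (1 <= gW x)%E.
Proof.
rewrite gW_abs /gW; case: ifP => // /negbT x0; case: ifP => [|_]; last exact: leey.
rewrite normr_id => x2.
have p : 0 < `|x| by rewrite lt_neqAle eq_sym x0 normr_ge0.
by rewrite lee_fin ler_pdivlMl// mulr1 ln_ratio_ge// p.
Qed.

(** The bound tends to 1 with r, which makes the convergence of the weight to 1 quantitative. *)
Lemma gW_le (r x : R) : `|x| <= r -> r < 2 -> (gW x <= (2 / (2 - r))%:E)%E.
Proof.
move=> xr r2; have r0 : 0 <= r by apply: le_trans xr.
have r2p : 0 < 2 - r by lra.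
rewrite gW_abs /gW; case: ifP => [_|/negbT x0].
  by rewrite lee_fin ler_pdivlMr// mul1r; lra.
have x2 : `|x| < 2 by apply: le_lt_trans r2.
rewrite normr_id x2 lee_fin.
have p : 0 < `|x| by rewrite lt_neqAle eq_sym x0 normr_ge0.
rewrite ler_pdivrMl// (le_trans (ln_ratio_le _)) ?p//.
rewrite ler_wpM2l// ler_wpM2l// lef_pV2 ?posrE; lra.
Qed.

Lemma measurable_inv (D : set R) : measurable_fun (D : set (measurableTypeR R)) (fun x : R => x^-1).
Proof.
(* At 0 both sides are 0. *)
have -> : (fun x : R => x^-1) = fun x => x * (x ^+ 2) `^ (-1).
  apply/funext => x; rewrite powR_inv1 ?sqr_ge0//.
  by have [->|x0] := eqVneq x 0; [rewrite invr0 mul0r|field].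
apply: measurable_funTS; apply: measurable_funM => //.
by apply: (@measurableT_comp _ _ _ _ _ _ (@powR R ^~ (-1))) => //; exact: measurable_funX.
Qed.

Lemma measurable_gW : measurable_fun setT (@gW R).
Proof.
have mid : measurable_fun setT (@id R) by [].
have mabs : measurable_fun setT (fun x : R => `|x|) by exact: measurableT_comp.
apply: measurable_fun_ifT => //; first exact: measurable_fun_eqr.
apply: measurable_fun_ifT => //; first exact: measurable_fun_ltr.
apply/measurable_EFinP; apply: measurable_funM; first exact: measurable_inv.
apply: (measurableT_comp (@measurable_ln R)); apply: measurable_funM; first exact: measurable_funD.
by apply: (measurableT_comp (@measurable_inv setT)); exact: measurable_funB.
Qed.

(** * Lower and upper limits of sequences, and the diagonal index *)

Lemma le_limn_einf (x : nat -> \bar R) (c : \bar R) (N : nat) :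
  (forall j, (N <= j)%N -> (c <= x j)%E) -> (c <= limn_einf x)%E.
Proof.
move=> h; rewrite limn_einf_lim (cvg_lim _ (@cvg_einfs_sup _ x)); last exact: ereal_hausdorff.
apply: (@le_trans _ _ (einfs x N)); last by apply: ereal_sup_ubound; exists N.
by apply/ereal_infP => _ [j /= Nj <-]; exact: h.
Qed.

Lemma limn_esup_le (x : nat -> \bar R) (c : \bar R) (N : nat) :
  (forall j, (N <= j)%N -> (x j <= c)%E) -> (limn_esup x <= c)%E.
Proof.
move=> h; rewrite limn_esup_lim (cvg_lim _ (@cvg_esups_inf _ x)); last exact: ereal_hausdorff.
apply: (@le_trans _ _ (esups x N)); first by apply: ereal_inf_lbound; exists N.
by apply: ub_ereal_sup => _ [j /= Nj <-]; exact: h.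
Qed.

Lemma cvge0_lt (x : nat -> \bar R) (e : R) : x @ \oo --> 0%E -> 0 < e ->
  exists N, forall n, (N <= n)%N -> (x n < e%:E)%E.
Proof.
move=> x0 e0.
have : \forall n \near \oo, (x n < e%:E)%E.
  apply: (x0 [set y | (y < e%:E)%E]).
  by apply: open_nbhs_nbhs; split; [exact: open_ereal_lt_ereal|rewrite /= lte_fin].
by move=> [N _ hN]; exists N.
Qed.

(** m is the largest n up to j with Q n, and defaults to 0 when there is none. *)
Lemma max_below (Q : nat -> Prop) (j : nat) :
  exists m, (forall n, (n <= j)%N -> Q n -> (n <= m)%N) /\
    ((exists2 n, (n <= j)%N & Q n) -> Q m).
Proof.
elim: j => [|j [m [h1 h2]]].
  by exists 0%N; split=> [n|[n]]; rewrite leqn0 => /eqP->.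
have [Qj|nQj] := pselect (Q j.+1).
  by exists j.+1; split.
exists m; split=> [n|[n]]; rewrite leq_eqVlt => /predU1P[->//|]; rewrite ltnS.
  exact: h1.
by move=> nj Qn; apply: h2; exists n.
Qed.

End WeightAndLimits.

(** * The approximating functionals *)

Section Recovery.
Context {R : realType}.
Notation mu := (@lebesgue_measure R).
Implicit Types (u v y : R -> 'rV[R]_3) (f g h : R -> R).

(** Hiding the derivative spares writing out that of [eta], of which only continuity and boundedness
    matter. *)
Definition C1b f := exists g, c1b f g.

Lemma C1bD f g : C1b f -> C1b g -> C1b (fun t => f t + g t).
Proof. by move=> [f' hf] [g' hg]; eexists; exact: c1bD hf hg. Qed.

Lemma C1bM f g : C1b f -> C1b g -> C1b (fun t => f t * g t).
Proof. by move=> [f' hf] [g' hg]; eexists; exact: c1bM hf hg. Qed.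

Lemma C1bB f g : C1b f -> C1b g -> C1b (fun t => f t - g t).
Proof. by move=> [f' hf] [g' hg]; eexists; exact: c1bD hf (c1bN hg). Qed.

Lemma C1b_dot (v w : R -> 'rV[R]_3) : (forall i, C1b (fun t => v t 0 i)) ->
  (forall i, C1b (fun t => w t 0 i)) -> C1b (fun t => dot (v t) (w t)).
Proof.
move=> hv hw; under eq_fun do rewrite dotE.
by apply: C1bD; [apply: C1bD|]; exact: C1bM.
Qed.

Lemma C1b_cross (v w : R -> 'rV[R]_3) i : (forall i, C1b (fun t => v t 0 i)) ->
  (forall i, C1b (fun t => w t 0 i)) -> C1b (fun t => cross (v t) (w t) 0 i).
Proof. by move=> hv hw; under eq_fun do rewrite mxE; apply: C1bB; exact: C1bM. Qed.

Lemma smooth01_C1b y j i : smooth01 y -> C1b (fun t => derive1n j y t 0 i).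
Proof.
move=> sy; have [_ dy _ _] := sy.
eexists; apply: c1b_ext (smooth01_c1b j i sy) => t It.
by rewrite derive1n_coord.
Qed.

(** [eta] is a polynomial in the classical derivatives and in 1/|y''|; the bound |y''| >= km keeps
    the square root and the inverse away from their singularities. *)
Lemma eta_Ykm A B (km p : R) y : 0 < km -> 0 < p -> Ykm A B km y ->
  exists f g, c1b f g /\ {ae mu, forall t, I01 t -> Defs.eta y t = f t}.
Proof.
move=> km0 p0 hy; have sy := Ykm_smooth hy; have [_ ykm] := hy.
have D j i := @smooth01_C1b y j i sy.
pose N t := enorm (derive1n 2 y t).
have [N' hN] : C1b N.
  have [g hg] := C1b_dot (D 2%N) (D 2%N).
  eexists; apply: (c1b_sqrt (c := km ^+ 2)) hg; first exact: exprn_gt0.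
  move=> t It; rewrite -sqr_enorm ler_pXn2r ?nnegrE ?enorm_ge0 ?(ltW km0)//.
  exact: ykm.
have VN : C1b (fun t => (N t)^-1) by eexists; apply: (c1bV (c := km)) hN.
have [g hg] := C1bM (C1b_dot (D 1%N) (fun i => C1b_cross i (D 2%N) (D 3%N))) (C1bM VN (C1bM VN VN)).
eexists; exists g; split; first exact: hg.
apply: ae_impl2 (smooth01_weakD3 1 sy) (ae_impl2 (fun t => @conj _ _) (smooth01_weakD3 2 sy)
  (smooth01_weakD3 3 sy)) => t h1 [h2 h3] It.
rewrite /Defs.eta (h1 It) (h2 It) (h3 It) -/(N t); congr (_ * _).
by rewrite !exprS expr0 mulr1 !invfM.
Qed.

Lemma ae_eq_locally_integrable f f' : locally_integrable I01 f -> measurable_fun I01 f' ->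
  {ae mu, forall t, I01 t -> f t = f' t} -> locally_integrable I01 f'.
Proof.
move=> [mf oI hf] mf' ff'; split => // K KI cK.
have mK : measurable (K : set (measurableTypeR R)) by exact: compact_measurable.
have mS (h : R -> R) : measurable_fun I01 h -> measurable_fun K (fun t => `|(h t)%:E|%E).
  move=> mh; apply: measurableT_comp => //; apply/measurable_EFinP.
  by apply: measurable_funS mh => //; exact: measurable_I01.
apply: le_lt_trans (hf K KI cK).
apply: ae_ge0_le_integral => //; [exact: mS mf'|exact: mS mf|].
by apply: ae_impl ff' => t h /KI It; rewrite (h It).
Qed.

(** The bound M is what makes eps * eta' small uniformly in t. *)
Lemma eta_weak_Ykm A B (km p : R) y : 0 < km -> 0 < p -> Ykm A B km y ->
  Wkp 1 1 (Defs.eta y) /\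
  exists2 M, 0 <= M & {ae mu, forall t, I01 t -> `|weakD 1 (Defs.eta y) t| <= M}.
Proof.
move=> km0 p0 hy; have [hW _ _] := Ykm_adm p0 hy.
have [f [g [fg ef]]] := eta_Ykm km0 p0 hy.
have fe : {ae mu, forall t, I01 t -> f t = Defs.eta y t}.
  by apply: ae_impl ef => t h It; rewrite (h It).
have le := ae_eq_locally_integrable (c1b_loc fg) (measurable_eta hW) fe.
have w0 : weak_derivative 0 (Defs.eta y) f.
  apply: ae_eq_weak_derivative (weak_derivative0_c1b fg) => //; first exact: c1b_loc fg.
  exact: aeW.
have w1 : weak_derivative 1 (Defs.eta y) g.
  apply: ae_eq_weak_derivative (weak_derivative1_c1b fg) => //; first exact: c1b_loc' fg.
  exact: aeW.
have [_ cg bf bg] := fg; split.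
  move=> [|[|//]] _.
    exists f => //; apply: Lp_bdd => //; exact: c1b_measurable fg.
  exists g => //; apply: Lp_bdd => //; exact: measurable_continuous_I01.
have [M hM] := bg; exists `|M| => //.
apply: ae_impl (weakD_ae w1) => t h It.
by rewrite (h It) (le_trans (hM _ It))// ler_norm.
Qed.

Lemma measurable_weight (eps : R) u : Wkp 1 1 (Defs.eta u) ->
  measurable_fun I01 (fun t => gW (eps * weakD 1 (Defs.eta u) t)).
Proof.
move=> h; have [g hg _] := h 1%N isT.
have [_ [mw _ _] _] := weakDP hg.
apply: (measurableT_comp (@measurable_gW R)).
by apply: measurable_funM => //; exact: measurable_cst.
Qed.

Lemma Sadowsky_epsE (eps : R) u : Wkp 1 1 (Defs.eta u) -> Sadowsky_eps eps u =
  (\int[mu]_(t in I01) ((density u t)%:E * gW (eps * weakD 1 (Defs.eta u) t)))%E.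
Proof. by move=> h; rewrite /Sadowsky_eps; case: asboolP. Qed.

Lemma Sadowsky_le_eps (eps p : R) u : Wkp3 3 p u -> (Sadowsky u <= Sadowsky_eps eps u)%E.
Proof.
move=> hW; have [h|h] := pselect (Wkp 1 1 (Defs.eta u)); last first.
  by rewrite /Sadowsky_eps; case: asboolP => // _; rewrite leey.
rewrite (Sadowsky_epsE _ h) SadowskyE.
have md : measurable_fun I01 (fun t => (density u t)%:E).
  by apply/measurable_EFinP; exact: measurable_density hW.
have g1 t := gW_ge1 (eps * weakD 1 (Defs.eta u) t).
have d0 t : (0 <= (density u t)%:E)%E by rewrite lee_fin; exact: sadowsky_density_ge0.
apply: ge0_le_integral.
- exact: measurable_I01.
- by move=> t _; exact: d0.
- exact: md.
- by apply: emeasurable_funM => //; exact: measurable_weight.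
- by move=> t _; rewrite lee_pemulr.
Qed.

Lemma Sadowsky_eps_le A B (km p de : R) y : 0 < km -> 0 < p -> 0 < de -> Ykm A B km y ->
  exists2 e0, 0 < e0 & forall eps, 0 < eps -> eps < e0 ->
    (Sadowsky_eps eps y <= (1 + de)%:E * Sadowsky y)%E.
Proof.
move=> km0 p0 de0 hy; have [hW _ _] := Ykm_adm p0 hy.
have [he [M M0 hM]] := eta_weak_Ykm km0 p0 hy.
(* r solves 2 / (2 - r) = 1 + de, the bound of [gW_le]. Below, M + 1 stands for M in a denominator,
   since M may be 0. *)
pose r := 2 * de / (1 + de).
have de1 : 0 < 1 + de by rewrite addr_gt0.
have r0 : 0 < r by rewrite divr_gt0// mulr_gt0.
have r2 : r < 2 by rewrite ltr_pdivrMr//; lra.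
have rE : 2 / (2 - r) = 1 + de by rewrite /r; field; rewrite !gt_eqF//; lra.
have M1 : 0 < M + 1 by rewrite ltr_wpDl.
exists (r / (M + 1)); first by rewrite divr_gt0.
move=> eps eps0; rewrite ltr_pdivlMr// => epsM.
have md : measurable_fun I01 (fun t => (density y t)%:E).
  by apply/measurable_EFinP; exact: measurable_density hW.
have g1 t := gW_ge1 (eps * weakD 1 (Defs.eta y) t).
have d0 t : (0 <= (density y t)%:E)%E by rewrite lee_fin; exact: sadowsky_density_ge0.
rewrite (Sadowsky_epsE _ he) SadowskyE -ge0_integralZl_EFin; last 4 first.
- exact: measurable_I01.
- by move=> t _; exact: d0.
- exact: md.
- exact: ltW.
apply: ae_ge0_le_integral.
- exact: measurable_I01.
- by move=> t _; apply: mule_ge0; [exact: d0|exact: le_trans (g1 t)].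
- by apply: emeasurable_funM => //; exact: measurable_weight.
- by move=> t _; apply: mule_ge0; [rewrite lee_fin ltW|exact: d0].
- exact: measurable_funeM.
apply: ae_impl hM => t h It; rewrite muleC; apply: lee_wpmul2r; first exact: d0.
rewrite -rE; apply: gW_le => //.
rewrite normrM (gtr0_norm eps0); apply: le_trans (ltW epsM).
rewrite ler_wpM2l ?(ltW eps0)// (le_trans (h It))// lerDl//.
Qed.

End Recovery.

(** * Gamma-convergence *)

Section GammaLimit.
Context {R : realType}.
Implicit Types (u v y : R -> 'rV[R]_3) (A B : 'rV[R]_3 * 'rV[R]_3).

(** At a smooth y close to u, semicontinuity of G and continuity of the functional cost e / 2
    each. *)
Lemma le_Sadowsky_Xkmp A B (km p : R) (G : (R -> 'rV[R]_3) -> R) :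
  0 < km -> 4 <= p -> lsc_on p (Xkmp A B km p) G ->
  (forall u, Ykm A B km u -> ((G u)%:E <= Sadowsky u)%E) ->
  forall u, Xkmp A B km p u -> ((G u)%:E <= Sadowsky u)%E.
Proof.
move=> km0 p4 lscG GY u hu; have p0 : 0 < p by apply: lt_le_trans p4.
apply/lee_addgt0Pr => e e0; have e20 : 0 < e / 2 by rewrite divr_gt0.
have [d1 d10 h1] := lscG u hu _ e20.
have [d2 d20 h2] := Sadowsky_continuous km0 p4 hu e20.
have [hWu happ] := hu.
have d0 : 0 < Num.min d1 d2 by rewrite lt_min d10.
have [y hy nd] := happ _ d0.
have hyX := Ykm_Xkmp p0 hy; have [hWy _] := hyX.
rewrite (Wkp3_normC p0 hWu hWy) in nd.
have nd1 : (Wkp3_norm 3 p (y \- u)%R < d1%:E)%E.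
  by apply: (lt_le_trans nd); rewrite lee_fin ge_min lexx.
have nd2 : (Wkp3_norm 3 p (y \- u)%R < d2%:E)%E.
  by apply: (lt_le_trans nd); rewrite lee_fin ge_min lexx orbT.
have Gy := h1 y hyX nd1; have [Fy _] := h2 y hyX nd2.
apply: (@le_trans _ _ ((G y)%:E + (e / 2)%:E)%E).
  by rewrite -EFinD lee_fin -lerBlDr ltW.
rewrite [X in (_ <= _ + X%:E)%E](_ : e = e / 2 + e / 2); last by field.
rewrite [X in (_ <= _ + X)%E]EFinD addeA; apply: leeD => //.
exact: le_trans (GY _ hy) Fy.
Qed.

Lemma Gamma_liminf A B (km p : R) (eps : nat -> R) u (us : nat -> R -> 'rV[R]_3) :
  0 < km -> 4 <= p -> Xkmp A B km p u -> (forall j, Xkmp A B km p (us j)) ->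
  W3p_cvg p us u ->
  (Sadowsky u <= limn_einf (fun j => Sadowsky_eps (eps j) (us j)))%E.
Proof.
move=> km0 p4 hu hus cv; apply/lee_addgt0Pr => e e0.
have [d d0 h] := Sadowsky_continuous km0 p4 hu e0.
have [N hN] := cvge0_lt cv d0.
rewrite -leeBlDr//; apply: (@le_limn_einf _ _ _ N) => j Nj.
rewrite leeBlDr//; have [_ hj] := h _ (hus j) (hN j Nj).
apply: (le_trans hj); rewrite leeD2r//; have [hW _] := hus j.
exact: Sadowsky_le_eps hW.
Qed.

Lemma Gamma_recovery A B (km p : R) (eps : nat -> R) u :
  0 < km -> 4 <= p -> Xkmp A B km p u -> (forall j, 0 < eps j) ->
  eps j @[j --> \oo] --> (0 : R) ->
  exists us : nat -> R -> 'rV[R]_3, [/\ forall j, Xkmp A B km p (us j), W3p_cvg p us u &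
    (limn_esup (fun j => Sadowsky_eps (eps j) (us j)) <= Sadowsky u)%E].
Proof.
move=> km0 p4 hu eps0 epscv; have p0 : 0 < p by apply: lt_le_trans p4.
have [hWu happ] := hu.
have ninv n : 0 < n.+1%:R^-1 :> R by rewrite invr_gt0.
have /choice[y hy] : forall n : nat, exists y, Ykm A B km y /\
    (Wkp3_norm 3 p (y \- u)%R < (n.+1%:R^-1 : R)%:E)%E.
  move=> n; have [y hy nd] := happ _ (ninv n); exists y; split; first exact: hy.
  by have [hWy _] := Ykm_Xkmp p0 hy; rewrite (Wkp3_normC p0 hWy hWu); exact: nd.
(* The diagonal takes at stage j the best approximant n up to j for which eps j is already small
   enough. *)
pose P n j := (Sadowsky_eps (eps j) (y n) <= (1 + n.+1%:R^-1)%:E * Sadowsky (y n))%E.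
have Pnear n : exists N, forall j, (N <= j)%N -> P n j.
  have [e0 e00 he] := Sadowsky_eps_le km0 p0 (ninv n) (hy n).1.
  have /cvgrPdist_lt/(_ _ e00)[N _ hN] := epscv.
  exists N => j Nj; apply: he => //.
  by have := hN j Nj; rewrite /= sub0r normrN gtr0_norm.
have /choice[m hm] : forall j, exists m, (forall n, (n <= j)%N -> P n j -> (n <= m)%N) /\
    ((exists2 n, (n <= j)%N & P n j) -> P m j) by move=> j; exact: max_below.
(* Each fixed n satisfies [P n j] for all large j, so the maximum m j tends to infinity. *)
have mge n : exists N, forall j, (N <= j)%N -> (n <= m j)%N.
  have [N hN] := Pnear n; exists (maxn N n) => j; rewrite geq_max => /andP[Nj nj].
  by have [h _] := hm j; apply: h => //; exact: hN.
(* Once [P 0 j] holds, m j is a genuine maximum and not the default value. *)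
have Pm : exists N, forall j, (N <= j)%N -> P (m j) j.
  have [N hN] := Pnear 0%N; exists N => j Nj.
  by have [_ h] := hm j; apply: h; exists 0%N => //; exact: hN.
have minv (e : R) : 0 < e -> exists N, forall j, (N <= j)%N -> (m j).+1%:R^-1 < e.
  move=> e0; have [n] := ltr_add_invr e0; rewrite add0r => ne.
  have [N hN] := mge n; exists N => j Nj; apply: le_lt_trans ne.
  by rewrite lef_pV2 ?posrE// ler_nat ltnS; exact: hN.
exists (fun j => y (m j)); split.
- by move=> j; apply: Ykm_Xkmp => //; exact: (hy _).1.
- rewrite /W3p_cvg; apply/fine_cvgP; split.
    apply: nearW => j; rewrite ge0_fin_numE; first exact: lt_trans (hy _).2 (ltry _).
    by apply: sume_ge0 => i _; exact: Lnorm_ge0.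
  apply/cvgrPdist_lt => e e0; have [N hN] := minv e e0.
  exists N => // j /= Nj; rewrite sub0r normrN.
  have := (hy (m j)).2; have : (0 <= Wkp3_norm 3 p (y (m j) \- u)%R)%E.
    by apply: sume_ge0 => i _; exact: Lnorm_ge0.
  case: (Wkp3_norm 3 p (y (m j) \- u)%R) => [z| |]//=.
  rewrite lee_fin lte_fin => z0 zm; rewrite ger0_norm//.
  by apply: lt_trans zm _; exact: hN.
- apply/lee_addgt0Pr => e e0.
  have S0 (w : R -> 'rV[R]_3) : (0 <= Sadowsky w)%E.
    by apply: integral_ge0 => t _; rewrite lee_fin; exact: sadowsky_density_ge0.
  have : Sadowsky u \is a fin_num.
    by rewrite ge0_fin_numE//; exact: Sadowsky_Xkmp_lty km0 p4 hu.
  case Eu : (Sadowsky u) (S0 u) => [x| |] // + _; rewrite lee_fin => x0.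
  pose d := Num.min 1 (e / 3).
  have d0 : 0 < d by rewrite lt_min ltr01 divr_gt0.
  have [de d1] : d <= e / 3 /\ d <= 1 by rewrite !ge_min !lexx orbT.
  have [r r0 hr] := Sadowsky_continuous km0 p4 hu d0.
  (* In (1 + s)(x + d) = x + d + s x + s d each of the last three terms is at most e / 3: d by its
     choice, s x by the last bound on s, and s d because s is at most 1. The bound r keeps the curve
     within the range of continuity. *)
  pose s := Num.min r (Num.min 1 (e / (3 * (x + 1)))).
  have x1 : 0 < 3 * (x + 1) by lra.
  have s0 : 0 < s by rewrite !lt_min r0 ltr01 divr_gt0.
  have sx : s * (3 * (x + 1)) <= e by rewrite -ler_pdivlMr// !ge_min lexx !orbT.
  have s1 : s <= 1 by rewrite !ge_min lexx orbT.
  have [N1 h1] := minv s s0; have [N2 h2] := Pm.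
  apply: (@limn_esup_le _ _ _ (maxn N1 N2)) => j; rewrite geq_max => /andP[j1 j2].
  apply: (le_trans (h2 j j2)).
  have ms := h1 j j1.
  have nr : (Wkp3_norm 3 p (y (m j) \- u)%R < r%:E)%E.
    apply: lt_le_trans (hy _).2 _; rewrite lee_fin.
    by apply: le_trans (ltW ms) _; rewrite ge_min lexx.
  have [Fy _] := hr _ (Ykm_Xkmp p0 (hy (m j)).1) nr.
  apply: (@le_trans _ _ ((1 + s)%:E * (x%:E + d%:E))%E).
    apply: lee_pmul => //.
    - by rewrite lee_fin lerD2l ltW.
    - by rewrite -Eu.
  rewrite -EFinD -EFinM -EFinD lee_fin.
  have : s * d <= d by rewrite ler_piMl ?(ltW d0).
  have : 0 <= s * x by rewrite mulr_ge0 ?(ltW s0).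
  lra.
Qed.

End GammaLimit.

Theorem theorem4p5 (R : realType) (A B : 'rV[R]_3 * 'rV[R]_3)
    (hA : enorm A.2 = 1) (hB : enorm B.2 = 1)
    (km p : R) (hkm : 0 < km) (hp : 4 <= p) :
  (forall G : (R -> 'rV[R]_3) -> R,
     lsc_on p (Xkmp A B km p) G ->
     (forall u, Ykm A B km u -> ((G u)%:E <= Sadowsky u)%E) ->
     forall u, Xkmp A B km p u -> ((G u)%:E <= Sadowsky u)%E) /\
  is_Gamma_limit (Xkmp A B km p) (W3p_cvg p) (@Sadowsky_eps R) (@Sadowsky R).
Proof.
split; first by move=> G; exact: le_Sadowsky_Xkmp.
move=> eps eps0 epscv u hu; split; last exact: Gamma_recovery hkm hp hu eps0 epscv.
by move=> us hus cv; exact: Gamma_liminf hkm hp hu hus cv.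
Qed.
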